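(* Let $F=f+\psi$ be strictly convex and let $\{x_i\}$ be the iterates of the Super-Universal Newton Method (described in the context) with parameters $\alpha\in[\tfrac23,1]$ and $H_0>0$. Let $M_q<+\infty$ for some $q\in[2,4]$, and $D_s<+\infty$ for some $s\in[q,+\infty]$. Assume that $H_0\le\mathcal H_\alpha(g_0)$ and that for all iterations $\{x_i\}_{i=0}^k$ the functional residual is big enough: $$F_i:=F(x_i)-F_*\ge\varepsilon,\qquad 0\le i\le k,$$ with some $\varepsilon>0$. Then $$k\ \le\ 16\Bigl(\frac{s-1}{s}\Bigr)^{\frac{q(s-1)}{s(q-1)}}\Bigl(\frac{6M_qD_s^q}{V_F^{q/s}}\Bigr)^{\frac1{q-1}}\frac{s(q-1)}{s-q}\Bigl[\varepsilon^{-\frac{s-q}{s(q-1)}}-F_0^{-\frac{s-q}{s(q-1)}}\Bigr]+2\ln\frac{g_0D}{\varepsilon}.$$ For $s=q$ the right-hand side is treated as its limit, which gives $$k\ \le\ 16\Bigl(\frac{q-1}{q}\Bigr)\Bigl(\frac{6M_qD_q^q}{V_F}\Bigr)^{\frac1{q-1}}\ln\frac{F_0}{\varepsilon}+2\ln\frac{g_0D}{\varepsilon}.$$ (For $s=+\infty$ the expressions in $s$ are understood as their limits, with $1/\infty=0$.)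
   Context: Spaces and norms. $\mathbb E$ is a finite-dimensional real vector space, $\mathbb E^*$ its dual, $\langle s,x\rangle$ the value of $s\in\mathbb E^*$ at $x\in\mathbb E$. $B:\mathbb E\to\mathbb E^*$ is a fixed self-adjoint positive-definite linear operator; $\|x\|=\langle Bx,x\rangle^{1/2}$ on $\mathbb E$ and $\|s\|_*=\langle s,B^{-1}s\rangle^{1/2}$ on $\mathbb E^*$. Norms of symmetric multilinear forms are induced: $\|\nabla^pf(x)\|=\max\{\nabla^pf(x)[h_1,\dots,h_p]:\ \|h_i\|\le1\}$. Notation: $\nabla^2 f(x)[h]^2=\langle\nabla^2f(x)h,h\rangle$. Problem. $\min_{x\in\operatorname{dom}\psi}\{F(x)=f(x)+\psi(x)\}$, where $f:\mathbb E\to\mathbb R$ is convex and several times differentiable and $\psi:\mathbb E\to\mathbb R\cup\{+\infty\}$ is a proper closed convex function; $F_*$ is the optimal value. Smoothness constants. $L_{p,\nu}=\sup_{x\ne y}\|\nabla^pf(x)-\nabla^pf(y)\|/\|x-y\|^\nu$ for $p\in\{2,3\}$, $\nu\in[0,1]$ (equal to $+\infty$ if the supremum is infinite or $\nabla^pf$ does not exist). For $2\le q\le4$: $M_{2+\nu}=L_{2,\nu}$ for $\nu\in[0,1)$ and $M_{3+\nu}=L_{3,\nu}$ for $\nu\in[0,1]$. Relative size. $\mathcal F_0=\{x\in\operatorname{dom}\psi:\ F(x)\le F(x_0)\}$ (with more than one point) and $D=\sup_{x,y\in\mathcal F_0}\|x-y\|$, assumed finite. Fix a selection of subgradients $G_x\in\partial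 F(x)$, $x\in\mathcal F_0$, and let $\beta_F(x,y)=\langle G_x-G_y,x-y\rangle$ (positive for $x\ne y$ by strict convexity), $V_F=\sup_{x,y\in\mathcal F_0}\beta_F(x,y)$, assumed finite, $\xi_F(x,y)=\beta_F(x,y)/V_F$. For $2\le s\le\infty$ the $s$-relative size is $D_s=\sup_{x,y\in\mathcal F_0,\,x\ne y}\|x-y\|\,\xi_F(x,y)^{-1/s}$, with $1/\infty=0$, so $D_\infty=D$. Function $\mathcal H_\alpha$. For $t>0$, $\mathcal H_\alpha(t)=\inf_{2\le q\le4}(6M_q)^{\frac1{q-1}}\bigl(\tfrac1t\bigr)^{\alpha-\frac{q-2}{q-1}}$. Super-Universal Newton Method. Input: $x_0\in\operatorname{dom}\psi$, $\psi'(x_0)\in\partial\psi(x_0)$, arbitrary $\alpha\in[\frac23,1]$, $H_0>0$. For $k=0,1,\dots$: set $F'(x_k)=\nabla f(x_k)+\psi'(x_k)$ and $g_k=\|F'(x_k)\|_*$. For $j_k=0,1,2,\dots$ put $\lambda_k=4^{j_k}H_kg_k^\alpha$, $x_+=\operatorname{argmin}_x\{\langle\nabla f(x_k),x-x_k\rangle+\frac12\nabla^2f(x_k)[x-x_k]^2+\frac{\lambda_k}2\|x-x_k\|^2+\psi(x)\}$, $\psi'(x_+)=-\nabla f(x_k)-\nabla^2f(x_k)(x_+-x_k)-\lambda_kB(x_+-x_k)\in\partial\psi(x_+)$, $F'(x_+)=\nabla f(x_+)+\psi'(x_+)$, stopping at the first $j_k$ for which $\langle F'(x_+),x_k-x_+\rangle\ge\frac{1}{4\lambda_k}\|F'(x_+)\|_*^2$.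 Then set $x_{k+1}=x_+$ (with the corresponding $\psi'(x_{k+1})$) and $H_{k+1}=4^{j_k}H_k/4$. *)

(* Defs.v *)
(* MathComp-Analysis. *)
From HB Require Import structures.
From mathcomp Require Import all_boot all_order all_algebra.
From mathcomp Require Import all_classical all_reals all_analysis.

Set Implicit Arguments.
Unset Strict Implicit.
Unset Printing Implicit Defensive.

Import Order.TTheory GRing.Theory Num.Theory.
Import numFieldNormedType.Exports.

Local Open Scope classical_set_scope.
Local Open Scope ring_scope.

(* A finite-dimensional vector space carrying some norm [`|x|].  The norm of
   the structure is arbitrary and only provides the (unique) vector space
   topology, used by [differentiable], ['D_h f] and [lower_semicontinuous];
   the norms of the problem are [primal_norm] and [dual_norm] below. *)
#[short(type="finNormedModType")]
HB.structure Definition FinNormedModule (R : numFieldType) :=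
  {E of Vector R E & NormedModule R E}.

Definition dual_space (R : realType) (E : finNormedModType R) := 'Hom(E, R^o).

Section Norms.
Context {R : realType} {E : finNormedModType R}.
Implicit Types (x y : E) (s : dual_space E).

Definition self_adjoint (B : 'Hom(E, dual_space E)) := forall x y, B x y = B y x.

Definition positive_definite (B : 'Hom(E, dual_space E)) :=
  forall x, x != 0 -> 0 < B x x.

Definition primal_norm (B : 'Hom(E, dual_space E)) x : R := Num.sqrt (B x x).

Definition dual_norm (B : 'Hom(E, dual_space E)) s : R := Num.sqrt (s ((B^-1)%VF s)).

Definition form_norm (B : 'Hom(E, dual_space E)) (p : nat) (T : seq E -> R) : \bar R :=
  ereal_sup [set (T h)%:E | h in [set h : seq E |
    size h = p /\ forall u, u \in h -> primal_norm B u <= 1]].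

End Norms.

Section Derivatives.
Context {R : realType} {E : finNormedModType R}.
Implicit Types (f : E -> R^o) (x h : E).

(* Since E is finite-dimensional, a map is p.+1 times Frechet differentiable
   iff it is differentiable and all its directional derivatives are p times
   differentiable. *)
Fixpoint times_differentiable (p : nat) f : Prop :=
  if p is p'.+1 then
    (forall x, differentiable f x) /\
    (forall h, times_differentiable p' (fun x => 'D_h f x))
  else True.

(* [nabla hs f x] is the value of the p-linear form of the p-th derivative of f
   at x on [hs = [:: h_1; ...; h_p]]. *)
Fixpoint nabla (hs : seq E) f : E -> R^o :=
  if hs is h :: hs' then fun x => 'D_h (nabla hs' f) x else f.

Definition grad f x : dual_space E := linfun ('d f x : E -> R^o).

Definition hess f x : 'Hom(E, dual_space E) :=
  linfun (fun h : E => linfun (fun v : E => nabla [:: h; v] f x) : dual_space E).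

Definition smoothness_const (B : 'Hom(E, dual_space E)) f (p : nat) (nu : R) : \bar R :=
  if `[< times_differentiable p f >] then
    ereal_sup [set (form_norm B p (fun hs => nabla hs f z.1 - nabla hs f z.2)%R
                    * ((primal_norm B (z.1 - z.2) `^ nu)^-1)%R%:E)%E
              | z in [set z : E * E | z.1 <> z.2]]
  else +oo%E.

(* [Mconst B f q] is M_q, 2 <= q <= 4. *)
Definition Mconst (B : 'Hom(E, dual_space E)) f (q : R) : \bar R :=
  if q < 3 then smoothness_const B f 2 (q - 2)
  else smoothness_const B f 3 (q - 3).

Definition Halpha (B : 'Hom(E, dual_space E)) f (alpha t : R) : \bar R :=
  ereal_inf [set (poweR (6%:E * Mconst B f q) (q - 1)^-1%R
                  * (t^-1 `^ (alpha - (q - 2) / (q - 1)))%R%:E)%E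
            | q in [set q : R | 2 <= q <= 4]].

End Derivatives.

Section ExtendedConvex.
Context {R : realType} {E : finNormedModType R}.
Implicit Types (phi : E -> \bar R) (x y : E) (t : R).

Definition edom phi : set E := [set x | phi x < +oo]%E.

Definition eproper phi :=
  (forall x, phi x != -oo%E) /\ (exists x, edom phi x).

Definition econvex phi := forall x y t, 0 <= t <= 1 ->
  (phi (t *: x + (1 - t) *: y)%R <= t%:E * phi x + (1 - t)%R%:E * phi y)%E.

Definition strictly_econvex phi := forall x y t,
  edom phi x -> edom phi y -> x != y -> 0 < t < 1 ->
  (phi (t *: x + (1 - t) *: y)%R < t%:E * phi x + (1 - t)%R%:E * phi y)%E.

Definition subdifferential phi x : set (dual_space E) :=
  [set s : dual_space E | phi x \is a fin_num /\
    forall y, (phi x + (s (y - x)%R)%:E <= phi y)%E].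

Definition is_argmin phi x := forall y, (phi x <= phi y)%E.

End ExtendedConvex.

Section CompositeProblem.
Context {R : realType} {E : finNormedModType R}.
Variables (B : 'Hom(E, dual_space E)) (f : E -> R^o) (psi : E -> \bar R).
Implicit Types (x y : E).

Definition objective x : \bar R := ((f x)%:E + psi x)%E.

Definition opt_value : \bar R := ereal_inf [set objective x | x in edom psi].

Definition residual x : \bar R := (objective x - opt_value)%E.

Definition level_set (x0 : E) : set E :=
  [set x | edom psi x /\ (objective x <= objective x0)%E].

Definition level_diam (x0 : E) : \bar R :=
  ereal_sup [set (primal_norm B (z.1 - z.2))%:E
            | z in [set z : E * E | level_set x0 z.1 /\ level_set x0 z.2]].

(* In the next definitions G is a selection of subgradients of the objective. *)
Definition betaF (G : E -> dual_space E) x y : R := (G x - G y) (x - y).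

Definition VF (G : E -> dual_space E) (x0 : E) : \bar R :=
  ereal_sup [set (betaF G z.1 z.2)%:E
            | z in [set z : E * E | level_set x0 z.1 /\ level_set x0 z.2]].

Definition xiF (G : E -> dual_space E) (x0 x y : E) : R :=
  betaF G x y / fine (VF G x0).

Definition inv_size (s : \bar R) : R := if s is r%:E%E then r^-1 else 0.

Definition relative_size (G : E -> dual_space E) (x0 : E) (s : \bar R) : \bar R :=
  ereal_sup [set (primal_norm B (z.1 - z.2) * xiF G x0 z.1 z.2 `^ (- inv_size s))%:E
            | z in [set z : E * E |
                [/\ level_set x0 z.1, level_set x0 z.2 & z.1 <> z.2]]].

Definition newton_model (x : E) (lambda : R) y : \bar R :=
  ((grad f x (y - x) + 2^-1 * hess f x (y - x) (y - x)
    + lambda / 2 * primal_norm B (y - x) ^+ 2)%R%:E + psi y)%E.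

Definition newton_subgrad (x : E) (lambda : R) y : dual_space E :=
  - grad f x - hess f x (y - x) - lambda *: B (y - x).

Definition newton_accept (x : E) (lambda : R) y : Prop :=
  let Fy := grad f y + newton_subgrad x lambda y in
  Fy (x - y) >= (4 * lambda)^-1 * dual_norm B Fy ^+ 2.

(* One iteration, from the state (x, psi'(x), H) to (x', psi'(x'), H'): [j] is
   the number of rejected trials and [T i] is the trial point for
   lambda i = 4^i H g^alpha. *)
Definition newton_step (alpha : R) (x : E) (dx : dual_space E) (H : R)
    (x' : E) (dx' : dual_space E) (H' : R) : Prop :=
  let lambda i := 4 ^+ i * H * dual_norm B (grad f x + dx) `^ alpha in
  exists (j : nat) (T : nat -> E),
    (forall i, (i <= j)%N -> is_argmin (newton_model x (lambda i)) (T i)) /\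
    (forall i, (i < j)%N -> ~ newton_accept x (lambda i) (T i)) /\
    newton_accept x (lambda j) (T j) /\
    x' = T j /\
    dx' = newton_subgrad x (lambda j) (T j) /\
    H' = 4 ^+ j * H / 4.

(* The sequences (x_i), (psi'(x_i)), (H_i) are generated by the first k
   iterations of the method; their values beyond index k are irrelevant. *)
Definition super_universal_newton (alpha : R) (k : nat)
    (x : nat -> E) (dpsi : nat -> dual_space E) (H : nat -> R) : Prop :=
  [/\ edom psi (x 0%N), subdifferential psi (x 0%N) (dpsi 0%N), 0 < H 0%N &
    forall i, (i < k)%N ->
      newton_step alpha (x i) (dpsi i) (H i) (x i.+1) (dpsi i.+1) (H i.+1)].

End CompositeProblem.

(* The iteration bound in terms of M = M_q, Ds = D_s, V = V_F, g0, D,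
   F0 = F(x_0) - F_* and eps.  The cases s = q and s = +oo are the limits of
   the generic formula; the last branch is only meaningful for s = +oo. *)
Definition rate_bound (R : realType) (q : R) (s : \bar R)
    (M Ds V g0 D F0 eps : R) : R :=
  match s with
  | r%:E%E =>
      if r == q then
        16 * ((q - 1) / q) * (6 * M * Ds `^ q / V) `^ (q - 1)^-1 * ln (F0 / eps)
      else
        16 * ((r - 1) / r) `^ (q * (r - 1) / (r * (q - 1)))
        * (6 * M * Ds `^ q / V `^ (q / r)) `^ (q - 1)^-1
        * (r * (q - 1) / (r - q))
        * (eps `^ (- ((r - q) / (r * (q - 1))))
           - F0 `^ (- ((r - q) / (r * (q - 1)))))
  | _ =>
      16 * (6 * M * Ds `^ q) `^ (q - 1)^-1 * (q - 1)
      * (eps `^ (- (q - 1)^-1) - F0 `^ (- (q - 1)^-1))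
  end + 2 * ln (g0 * D / eps).

(* Main.v *)
(* One accepted step from x with parameter lambda and g = |F'(x)|_*: the
   acceptance test gives F(x) - F(x_+) >= |F'(x_+)|_*^2 / (4 lambda).  Writing
   F'(x_+) = w - lambda B h with h = x_+ - x and w the Taylor remainder of
   grad f, the test holds as soon as |w|_* <= lambda |h|, which is guaranteed by
   lambda >= (6 M_q)^(1/(q-1)) g^((q-2)/(q-1)); for q >= 3 the third derivative
   along h is absorbed using convexity of f.  Since |F'(x_+)|_* <= 4 g, the
   bound H_k <= 4 (6 M_q)^(1/(q-1)) g_k^((q-2)/(q-1)-alpha) propagates, so
   lambda_k <= 4 (6 M_q)^(1/(q-1)) g_k^((q-2)/(q-1)).  The relative size D_s
   makes F uniformly convex of degree s on the level set, hence
   F_k^p <= A g_k^(q/(q-1)) with p = q(s-1)/(s(q-1)), and altogether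
     F_(k+1)^p (g_(k+1)/g_k)^((q-2)/(q-1)) <= K (F_k - F_(k+1)).
   Comparing with the potential t |-> t^(1-p)/(p-1) (or -ln t) and bounding the
   ratios of consecutive F_k and g_k below through their logarithms gives the
   rate, the sum of the logarithms producing the term 2 ln (g_0 D / eps). *)
Require Import Defs.
From HB Require Import structures.
From mathcomp Require Import all_boot all_order all_algebra.
From mathcomp Require Import all_classical all_reals all_analysis.
From mathcomp Require Import ring lra.

Set Implicit Arguments.
Unset Strict Implicit.
Unset Printing Implicit Defensive.

Import Order.TTheory GRing.Theory Num.Theory.
Import numFieldNormedType.Exports.

Local Open Scope classical_set_scope.
Local Open Scope ring_scope.

(** * Scalar inequalities: powers, discrete integration, potentials, step counting *)

Section RealInequalities.
Context {R : realType}.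
Implicit Types a b c p q s t z : R.

(** Young's inequality for [z] and 1 with exponents s and s/(s-1), multiplied by s. *)
Lemma bernoulli_powR z s : 0 <= z -> 1 <= s -> 1 + s * (z - 1) <= z `^ s.
Proof.
move=> z0; rewrite le_eqVlt => /predU1P[<-|s1].
  by rewrite powRr1//; lra.
have s0 : 0 < s by lra.
have c0 : 0 < s / (s - 1) by rewrite divr_gt0//; lra.
have e : s^-1 + (s / (s - 1))^-1 = 1 by field; lra.
have := conjugate_powR z0 ler01 s0 c0 e.
rewrite powR1 mulr1 -(ler_pM2r s0) mulrDl divfK ?gt_eqF//.
have -> : 1 / (s / (s - 1)) * s = s - 1 by field; lra.
by lra.
Qed.

(** Tangent bound for the convex power t^s: Bernoulli at b/a, scaled by a^s. *)
Lemma powR_sub_le a b s : 0 <= b <= a -> 1 <= s ->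
  a `^ s - b `^ s <= s * a `^ (s - 1) * (a - b).
Proof.
move=> /andP[b0 ba] s1; have s0 : 0 < s by lra.
have [a0|a0] := eqVneq a 0.
  have -> : b = a by lra.
  by rewrite !subrr mulr0.
have {}a0 : 0 < a by lra.
have := bernoulli_powR (divr_ge0 b0 (ltW a0)) s1.
have as0 : 0 < a `^ s by rewrite powR_gt0.
have -> : b `^ s = (b / a) `^ s * a `^ s.
  by rewrite -powRM ?divfK ?divr_ge0 ?gt_eqF// ltW.
have e : a `^ s = a * a `^ (s - 1) by rewrite mulr_powRB1// ltW.
rewrite -(ler_pM2r as0) => h.
have -> : s * a `^ (s - 1) * (a - b) = s * (1 - b / a) * a `^ s.
  by rewrite e; field; rewrite gt_eqF.
by nra.
Qed.

Lemma ge_archi_le a b c : (forall n : nat, a - b / n.+1%:R <= c) -> a <= c.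
Proof.
move=> h; rewrite leNgt; apply/negP => ca.
have d0 : 0 < a - c by lra.
pose n := Num.truncn (`|b| / (a - c)).
have := h n; have : `|b| / (a - c) < n.+1%:R by exact: truncnS_gt.
rewrite ltr_pdivrMr// => h1.
have n0 : 0 < n.+1%:R :> R by rewrite ltr0n.
have : b / n.+1%:R < a - c.
  by rewrite ltr_pdivrMr// mulrC; apply: le_lt_trans h1; exact: ler_norm.
by set u := b / _ => h2 h3; lra.
Qed.

(* Left Riemann sums of c t^(s-1) give the constant c / s. *)
Lemma uniformly_convex_segment (phi gam : R -> R) p c s : 1 <= s -> 0 <= c ->
  (forall t u, 0 <= t <= 1 -> 0 <= u <= 1 -> phi t + gam t * (u - t) <= phi u) ->
  (forall t u, 0 <= u -> u < t -> t <= 1 -> c * (t - u) `^ (s - 1) <= gam t - gam u) ->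
  (forall u, 0 <= u <= 1 -> phi 0 + p * u <= phi u) ->
  phi 0 + p + c / s <= phi 1.
Proof.
move=> s1 c0 hphi hgam hp; have s0 : 0 < s by lra.
(* With mesh 1/n the sum stops two cells short; Bernoulli bounds the loss in ((n-2)/n)^s by 2s/n,
   hence an error 2c/n. *)
apply: (@ge_archi_le _ (2 * c)) => m.
pose n := m.+1; pose N : R := n%:R.
have N0 : 0 < N by rewrite ltr0n.
have iN0 : 0 < N^-1 by rewrite invr_gt0.
have nN : N * N^-1 = 1 by rewrite divff ?gt_eqF.
have tN i : (i <= n)%N -> 0 <= i%:R / N <= 1.
  by move=> iin; rewrite divr_ge0 ?(ltW N0)//= ler_pdivrMr// mul1r ler_nat.
(* [p] is the slope of some affine minorant exact at 0 and may differ from [gam 0], so it is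
   compared with [gam] at the first positive node. *)
have g1 : p <= gam (1 / N).
  have h1 := hp (1 / N) (tN 1%N isT).
  have z01 : 0 <= (0 : R) <= 1 by rewrite lexx ler01.
  have := hphi (1 / N) 0 (tN 1%N isT) z01.
  rewrite !mul1r in h1 * => h2.
  by rewrite -(ler_pM2r iN0); lra.
(* The indicator removes the term at i = 0: there the two nodes coincide and [hgam] says nothing,
   while 0^(s-1) equals 1 when s = 1. *)
have gi i : (i < n)%N -> p + c * (i%:R / N) `^ (s - 1) * (i%:R != 0 :> R)%:R
    <= gam (i.+1%:R / N).
  case: i => [|i] iin; first by rewrite eqxx mulr0 addr0.
  rewrite pnatr_eq0/= mulr1.
  have := @hgam (i.+2%:R / N) (1 / N).
  have -> : i.+2%:R / N - 1 / N = i.+1%:R / N by rewrite -mulrBl -addn1 natrD addrK.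
  have /andP[_ t1] := tN _ iin.
  have /andP[t0 _] := tN 1%N isT.
  rewrite t1 t0 ltr_pM2r// ltr1n => /(_ isT isT isT).
  by lra.
have P i : (i < n)%N ->
    phi 0 + p * (i.+1%:R / N) + c / s * (i.-1%:R / N) `^ s <= phi (i.+1%:R / N).
  elim: i => [|i IH] iin.
    rewrite /= mul0r powR0 ?gt_eqF// mulr0 addr0; apply: hp; exact: tN.
  have {}IH := IH (ltnW iin).
  have h1 := gi i (ltnW iin).
  have := hphi (i.+1%:R / N) (i.+2%:R / N) (tN _ (ltnW iin)) (tN _ iin).
  have e : i.+2%:R / N = i.+1%:R / N + N^-1.
    by rewrite -[in LHS]addn1 natrD mulrDl mul1r.
  have -> : i.+2%:R / N - i.+1%:R / N = N^-1 by rewrite e addrAC subrr add0r.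
  move=> h2 /=.
  apply: le_trans h2; rewrite {1}e.
  suff : c / s * (i%:R / N) `^ s - c / s * (i.-1%:R / N) `^ s <=
      c * (i%:R / N) `^ (s - 1) * (i%:R != 0 :> R)%:R * N^-1 by nra.
  case: (i) => [|j] /=.
    by rewrite subrr eqxx mulr0 mul0r.
  rewrite pnatr_eq0/= mulr1.
  have ej : j.+1%:R / N = j%:R / N + N^-1.
    by rewrite -[in LHS]addn1 natrD mulrDl mul1r.
  have ji : 0 <= j%:R / N <= j.+1%:R / N.
    by rewrite divr_ge0 ?(ltW N0)//= ej lerDl ltW.
  have := powR_sub_le ji s1.
  have -> : j.+1%:R / N - j%:R / N = N^-1 by rewrite ej addrAC subrr add0r.
  move=> h3.
  rewrite -mulrBr.
  apply: le_trans (ler_wpM2l (divr_ge0 c0 (ltW s0)) h3) _.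
  by rewrite le_eqVlt; apply/orP; left; apply/eqP; field; rewrite (gt_eqF s0) andbT gt_eqF.
have := P m (ltnSn m); rewrite divff ?gt_eqF// mulr1.
apply: le_trans; rewrite -[leLHS]addrA lerD2l.
case: m @n @N N0 iN0 nN {tN g1 gi P} => [|m] n N N0 iN0 nN.
  rewrite /= mul0r powR0 ?gt_eqF// mulr0 divr1.
  suff : c / s <= c by lra.
  by rewrite ler_pdivrMr// ler_peMr.
rewrite /=; have := bernoulli_powR (divr_ge0 (ler0n R m) (ltW N0)) s1.
have -> : m%:R / N - 1 = - (2 / N).
  have -> : m%:R = N - 2 by rewrite /N /n -addn2 natrD addrK.
  by field; rewrite gt_eqF.
move=> h; have := ler_wpM2l (divr_ge0 c0 (ltW s0)) h; apply: le_trans.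
rewrite -[m.+2%:R]/N; move: N N0 {iN0 nN h} => {n} N N0.
by rewrite le_eqVlt; apply/orP; left; apply/eqP; field; rewrite (gt_eqF s0) andbT gt_eqF.
Qed.

(** The right side is the Fenchel conjugate of r |-> V (r/D)^s / s at [g]. Young's inequality is
    applied to V^(1/s) r/D and g D / V^(1/s), whose product is g r. *)
Lemma young_conjugate_bound (g r D V s : R) :
  0 <= g -> 0 <= r -> 0 < D -> 0 < V -> 1 < s ->
  g * r - V * (r / D) `^ s / s
    <= (s - 1) / s * (g * D / V `^ s^-1) `^ (s / (s - 1)).
Proof.
move=> g0 r0 D0 V0 s1; have s0 : 0 < s by lra.
have c0 : 0 < s / (s - 1) by rewrite divr_gt0//; lra.
have e : s^-1 + (s / (s - 1))^-1 = 1 by field; lra.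
have V0' : 0 < V `^ s^-1 by rewrite powR_gt0.
have a0 : 0 <= V `^ s^-1 * (r / D) by rewrite mulr_ge0 ?divr_ge0// ltW.
have b0 : 0 <= g * D / V `^ s^-1 by rewrite divr_ge0 ?mulr_ge0// ltW.
have := conjugate_powR a0 b0 s0 c0 e.
have -> : (V `^ s^-1 * (r / D)) `^ s = V * (r / D) `^ s.
  rewrite powRM ?(ltW V0')// ?divr_ge0 ?(ltW D0)//.
  by rewrite -powRrM mulVf ?gt_eqF// powRr1// ltW.
have -> : V `^ s^-1 * (r / D) * (g * D / V `^ s^-1) = g * r.
  by field; rewrite !gt_eqF.
by rewrite invf_div (mulrC _ ((s - 1) / s)); lra.
Qed.

(** Convexity of t |-> t^(-m)/m. Dividing by a^(-m) leaves 1 - u <= (u^(-m) - 1)/m for u = b/a,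
    which follows from exp(x) >= 1 + x and ln u <= u - 1. *)
Lemma powR_potential_le a b m : 0 < b -> 0 < a -> 0 < m ->
  (a - b) * a `^ (- (1 + m)) <= b `^ (- m) / m - a `^ (- m) / m.
Proof.
move=> b0 a0 m0.
have ba0 : 0 < b / a by rewrite divr_gt0.
have am0 : 0 < a `^ (- m) by rewrite powR_gt0.
have -> : (a - b) * a `^ (- (1 + m)) = (1 - b / a) * a `^ (- m).
  rewrite opprD powRD ?(gt_eqF a0) ?implybT// powR_inv1 ?(ltW a0)//.
  by field; rewrite gt_eqF.
have -> : b `^ (- m) = (b / a) `^ (- m) * a `^ (- m).
  by rewrite -powRM ?(ltW ba0) ?(ltW a0)// divfK ?gt_eqF.
set u := a `^ (- m) in am0 *; set v := (b / a) `^ (- m).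
have -> : v * u / m - u / m = (v - 1) / m * u by field; rewrite gt_eqF.
rewrite ler_pM2r// /v {u v am0}.
rewrite ler_pdivlMr// lerBrDr.
rewrite /powR gt_eqF//; apply: le_trans (expR_ge1Dx _).
have ba1 : -1 < b / a - 1 by lra.
have := le_ln1Dx ba1; rewrite addrC subrK => h.
by nra.
Qed.

(** The limit m -> 0 of the previous bound; it provides the potential -ln t for p = 1. *)
Lemma ln_potential_le a b : 0 < b -> 0 < a -> (a - b) / a <= ln a - ln b.
Proof.
move=> b0 a0; have ba0 : 0 < b / a by rewrite divr_gt0.
have ba1 : -1 < b / a - 1 by lra.
have := le_ln1Dx ba1; rewrite addrC subrK => h.
by move: h; rewrite ln_div ?posrE// mulrBl divff ?gt_eqF//; lra.
Qed.

(* Each step contributes 1 + p ln(F_{i+1}/F_i) + theta ln(g_{i+1}/g_i), because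
   the product of powers in the hypothesis is at least 1 plus its logarithm. *)
Lemma iteration_count (F g : nat -> R) (Phi : R -> R) p theta K (k : nat) :
  0 < K ->
  (forall i, (i <= k)%N -> 0 < F i) -> (forall i, (i <= k)%N -> 0 < g i) ->
  (forall a b, 0 < b -> 0 < a -> (a - b) * a `^ (- p) <= Phi b - Phi a) ->
  (forall i, (i < k)%N ->
     F i.+1 `^ p * (g i.+1 / g i) `^ theta <= K * (F i - F i.+1)) ->
  k%:R <= K * (Phi (F k) - Phi (F 0%N))
          + theta * ln (g 0%N / g k) + p * ln (F 0%N / F k).
Proof.
move=> K0 F0 g0 hPhi hF.
suff h i : (i <= k)%N -> i%:R <= K * (Phi (F i) - Phi (F 0%N))
    + theta * (ln (g 0%N) - ln (g i)) + p * (ln (F 0%N) - ln (F i)).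
  by rewrite !ln_div ?posrE ?F0 ?g0//; exact: h.
elim: i => [|i IH] ik; first by rewrite !subrr !mulr0 !addr0.
have {}IH := IH (ltnW ik).
have Fi := F0 i (ltnW ik); have Fi1 := F0 _ ik.
have gi := g0 i (ltnW ik); have gi1 := g0 _ ik.
have h1 := hF i ik; have h2 := hPhi _ _ Fi1 Fi.
have Fp : 0 < F i `^ (- p) by rewrite powR_gt0.
have h3 : (F i.+1 / F i) `^ p * (g i.+1 / g i) `^ theta <=
    K * (Phi (F i.+1) - Phi (F i)).
  apply: (@le_trans _ _ (K * ((F i - F i.+1) * F i `^ (- p)))); last first.
    by rewrite ler_pM2l.
  rewrite mulrA powRM ?invr_ge0 ?(ltW Fi) ?(ltW Fi1)//.
  rewrite -(powR_inv1 (ltW Fi)) -powRrM mulN1r.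
  by rewrite mulrAC ler_pM2r.
have : 1 + (p * ln (F i.+1 / F i) + theta * ln (g i.+1 / g i)) <=
    (F i.+1 / F i) `^ p * (g i.+1 / g i) `^ theta.
  by rewrite /powR !gt_eqF ?divr_gt0// -expRD; exact: expR_ge1Dx.
rewrite !ln_div ?posrE// -natr1.
by lra.
Qed.

End RealInequalities.

(** * From one-step estimates to a rate *)

Section AbstractRate.
Context {R : realType}.

(** Since theta + q/(q-1) = 2, the growth bound turns F_(i+1)^p g_(i+1)^theta into A g_(i+1)^2,
    which the decrease hypothesis controls; [iteration_count] then applies with the constant 16 C
    A. *)
Lemma abstract_rate (F g : nat -> R) (Phi : R -> R) (p q C A D eps : R) (k : nat) :
  2 <= q -> 0 <= p <= q / (q - 1) -> 0 < C -> 0 < A -> 0 < eps ->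
  (forall i, (i <= k)%N -> 0 < g i) -> (forall i, (i <= k)%N -> eps <= F i) ->
  (forall i, (i <= k)%N -> F i <= g i * D) ->
  (forall i, (i <= k)%N -> F i `^ p <= A * g i `^ (q / (q - 1))) ->
  (forall i, (i < k)%N ->
     g i.+1 ^+ 2 <= 16 * C * g i `^ ((q - 2) / (q - 1)) * (F i - F i.+1)) ->
  (forall a b, 0 < b -> 0 < a -> (a - b) * a `^ (- p) <= Phi b - Phi a) ->
  k%:R <= 16 * C * A * (Phi eps - Phi (F 0%N)) + 2 * ln (g 0%N * D / eps).
Proof.
move=> q2 /andP[p0 pq] C0 A0 e0 g0 eF FD FA dec hPhi.
have q1 : 0 < q - 1 by lra.
set theta := (q - 2) / (q - 1) in dec *.
have th0 : 0 <= theta by rewrite divr_ge0; lra.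
have thq : theta + q / (q - 1) = 2 by rewrite /theta; field; rewrite gt_eqF.
have F0 i : (i <= k)%N -> 0 < F i by move=> ik; exact: lt_le_trans (eF i ik).
have K0 : 0 < 16 * C * A by rewrite !mulr_gt0.
have step i : (i < k)%N -> F i.+1 `^ p * (g i.+1 / g i) `^ theta <=
    16 * C * A * (F i - F i.+1).
  move=> ik; have gi := g0 i (ltnW ik); have gi1 := g0 _ ik.
  have gp : 0 < g i `^ theta by rewrite powR_gt0.
  rewrite powRM ?invr_ge0 ?(ltW gi) ?(ltW gi1)//.
  rewrite -(powR_inv1 (ltW gi)) -powRrM mulN1r powRN mulrA ler_pdivrMr//.
  apply: (@le_trans _ _ (A * g i.+1 `^ (q / (q - 1)) * g i.+1 `^ theta)).
    by rewrite ler_wpM2r ?powR_ge0// FA.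
  rewrite -mulrA -powRD; last by rewrite (gt_eqF gi1) implybT.
  rewrite addrC thq powR_mulrn ?(ltW gi1)//.
  have := dec i ik; rewrite -(ler_pM2l A0) => /le_trans; apply.
  by rewrite le_eqVlt; apply/orP; left; apply/eqP; ring.
have F0k := F0 _ (leq0n k); have Fk := F0 _ (leqnn k).
have g0k := g0 _ (leq0n k); have gk := g0 _ (leqnn k).
apply: (le_trans (iteration_count K0 F0 g0 hPhi step)).
have hk := eF _ (leqnn k); have h0 := eF _ (leq0n k).
have D0 : 0 < D.
  by have := lt_le_trans F0k (FD _ (leq0n k)); rewrite pmulr_rgt0.
(* The tangent inequality for [Phi] itself gives this monotonicity, because eps <= F k. *)
have PhiL : Phi (F k) <= Phi eps.
  rewrite -subr_ge0; apply: le_trans (hPhi _ _ e0 Fk).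
  by rewrite mulr_ge0 ?powR_ge0// subr_ge0.
(* From eps <= F_k <= g_k D the gradient norm g_k is at least eps/D; the next bound uses F_0 <= g_0
   D instead. *)
have L1 : ln (g 0%N / g k) <= ln (g 0%N * D / eps).
  rewrite ler_ln ?posrE ?divr_gt0 ?mulr_gt0//.
  rewrite ler_pdivrMr// mulrAC ler_pdivlMr// -mulrA ler_pM2l//.
  by rewrite mulrC (le_trans hk)// FD.
have L2 : ln (F 0%N / F k) <= ln (g 0%N * D / eps).
  rewrite ler_ln ?posrE ?divr_gt0 ?mulr_gt0//.
  by rewrite ler_pM ?invr_ge0 ?(ltW F0k) ?(ltW Fk) ?FD// lef_pV2 ?posrE.
have L0 : 0 <= ln (g 0%N * D / eps).
  by rewrite ln_ge0// ler_pdivlMr// mul1r (le_trans h0)// FD.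
rewrite -addrA; apply: lerD; first by rewrite ler_pM2l// lerB.
(* Both logarithms share one bound, and theta + p <= theta + q/(q-1) = 2 produces the factor 2. *)
apply: (@le_trans _ _ ((theta + p) * ln (g 0%N * D / eps))).
  by rewrite mulrDl lerD// ler_wpM2l.
by rewrite ler_wpM2r//; lra.
Qed.

End AbstractRate.

(** * Euclidean norms induced by [B], and the acceptance test *)

Section PrimalDualNorms.
Context {R : realType} {E : finNormedModType R}.
Variable B : 'Hom(E, dual_space E).
Hypotheses (Bsym : self_adjoint B) (Bpos : positive_definite B).
Implicit Types (x y u h : E) (s w : dual_space E) (c lambda : R).

Lemma form_ge0 x : 0 <= B x x.
Proof.
by have [->|x0] := eqVneq x 0; [rewrite linear0 lexx|rewrite ltW// Bpos].
Qed.

Lemma primal_norm_ge0 x : 0 <= primal_norm B x.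
Proof. exact: sqrtr_ge0. Qed.

Lemma sqr_primal_norm x : primal_norm B x ^+ 2 = B x x.
Proof. by rewrite sqr_sqrtr// form_ge0. Qed.

Lemma primal_norm_gt0 x : x != 0 -> 0 < primal_norm B x.
Proof. by move=> x0; rewrite sqrtr_gt0 Bpos. Qed.

Lemma formZ c x y : B (c *: x) y = c * B x y.
Proof. by rewrite linearZ scale_lfunE. Qed.

Lemma formZr c x y : B x (c *: y) = c * B x y.
Proof. by rewrite linearZ. Qed.

Lemma formD x x' y : B (x + x') y = B x y + B x' y.
Proof. by rewrite linearD add_lfunE. Qed.

Lemma formDr x y y' : B x (y + y') = B x y + B x y'.
Proof. by rewrite linearD. Qed.

Lemma primal_normZ c x : primal_norm B (c *: x) = `|c| * primal_norm B x.
Proof.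
rewrite /primal_norm formZ formZr mulrA -expr2 sqrtrM ?sqr_ge0//.
by rewrite sqrtr_sqr.
Qed.

Lemma primal_normN x : primal_norm B (- x) = primal_norm B x.
Proof. by rewrite -scaleN1r primal_normZ normrN1 mul1r. Qed.

Lemma form_cauchy_schwarz x y : `|B x y| <= primal_norm B x * primal_norm B y.
Proof.
have [->|y0] := eqVneq y 0.
  by rewrite linear0 normr0 mulr_ge0// primal_norm_ge0.
have Byy : 0 < B y y by exact: Bpos.
rewrite -ler_sqr ?nnegrE ?mulr_ge0 ?primal_norm_ge0// exprMn !sqr_primal_norm.
rewrite real_normK ?num_real//.
have := form_ge0 (B y y *: x + (- B x y) *: y).
rewrite formD !formDr !formZ !formZr (Bsym y x) => h.
have {}h : 0 <= B y y * (B x x * B y y - B x y ^+ 2) by nra.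
by move: h; rewrite pmulr_rge0// subr_ge0.
Qed.

(** The generalised inverse is a right inverse on the image. Positivity makes [B] injective, and
    equal dimensions of the space and its dual make the image full. *)
Lemma formVK s : B ((B^-1)%VF s) = s.
Proof.
have kB : lker B == 0%VS.
  apply/lker0P => x y Bxy; apply/eqP; rewrite -subr_eq0; apply/negPn/negP.
  move=> /Bpos; have -> : B (x - y) = 0 by rewrite linearB/= Bxy subrr.
  by rewrite zero_lfunE ltxx.
apply: limg_lfunVK.
suff -> : limg B = fullv by exact: memvf.
apply/eqP; rewrite -dimv_leqif_eq ?subvf// limg_dim_eq; last first.
  by rewrite (eqP kB) capv0.
by rewrite !dimvf /dim /= muln1.
Qed.

Lemma formKV x : (B^-1)%VF (B x) = x.
Proof.
apply/eqP; rewrite -subr_eq0; apply/negPn/negP => /Bpos.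
have -> : B ((B^-1)%VF (B x) - x) = 0 by rewrite linearB/= formVK subrr.
by rewrite zero_lfunE ltxx.
Qed.

Lemma dual_norm_primal s : dual_norm B s = primal_norm B ((B^-1)%VF s).
Proof. by rewrite /primal_norm formVK. Qed.

Lemma dual_norm_form x : dual_norm B (B x) = primal_norm B x.
Proof. by rewrite dual_norm_primal formKV. Qed.

Lemma dual_norm_ge0 s : 0 <= dual_norm B s.
Proof. exact: sqrtr_ge0. Qed.

Lemma ler_dual_pairing s u : `|s u| <= dual_norm B s * primal_norm B u.
Proof. by rewrite dual_norm_primal -{1}(formVK s) form_cauchy_schwarz. Qed.

(** Testing at the preimage of [s] under [B] suffices: there the pairing is the square of the dual
    norm. *)
Lemma dual_norm_le s c : 0 <= c -> (forall u, `|s u| <= c * primal_norm B u) ->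
  dual_norm B s <= c.
Proof.
move=> c0 h; have := h ((B^-1)%VF s); rewrite -dual_norm_primal.
rewrite -{1}(formVK s) -sqr_primal_norm -dual_norm_primal ger0_norm ?sqr_ge0//.
have [->//|n0] := eqVneq (dual_norm B s) 0.
by rewrite expr2 ler_pM2r// lt_neqAle eq_sym n0 dual_norm_ge0.
Qed.

Lemma sqr_dual_normD s w :
  dual_norm B (s + w) ^+ 2 =
  dual_norm B s ^+ 2 + 2 * s ((B^-1)%VF w) + dual_norm B w ^+ 2.
Proof.
rewrite !dual_norm_primal !sqr_primal_norm linearD/= formD !formDr.
rewrite (Bsym ((B^-1)%VF w) ((B^-1)%VF s)) !formVK.
by lra.
Qed.

(** Expanding the squared norm of w = s + lambda B h cancels lambda^2 |h|^2 and leaves |s|^2 <= 2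
    lambda s(-h), twice as strong as the acceptance test. *)
Lemma dual_pairing_ge_of_remainder s w h lambda : 0 < lambda ->
  s = w - lambda *: B h -> dual_norm B w <= lambda * primal_norm B h ->
  (4 * lambda)^-1 * dual_norm B s ^+ 2 <= s (- h).
Proof.
move=> l0 -> hw; set s' := w - _.
have ws : w = s' + B (lambda *: h) by rewrite linearZ subrK.
have := sqr_dual_normD s' (B (lambda *: h)).
rewrite -ws formKV dual_norm_form primal_normZ gtr0_norm// linearZ/= linearN.
have : dual_norm B w ^+ 2 <= (lambda * primal_norm B h) ^+ 2.
  by rewrite ler_sqr ?nnegrE// ?mulr_ge0 ?(ltW l0)// ?dual_norm_ge0 ?primal_norm_ge0.
rewrite ler_pdivrMl ?mulr_gt0// => h1 h2.
have := sqr_ge0 (dual_norm B s').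
rewrite /GRing.scale/= in h2.
by nra.
Qed.

(** Cauchy-Schwarz for s(-h), divided by the norm of [s]. Together with lambda |h| <= g it limits
    the growth of the gradient norm in one step to a factor 4. *)
Lemma dual_norm_le_of_accept s h lambda : 0 < lambda ->
  (4 * lambda)^-1 * dual_norm B s ^+ 2 <= s (- h) ->
  dual_norm B s <= 4 * (lambda * primal_norm B h).
Proof.
move=> l0; have := ler_dual_pairing s (- h); rewrite primal_normN => h1.
rewrite ler_pdivrMl ?mulr_gt0// => h2.
have {}h1 := le_trans (ler_norm _) h1.
have [->|n0] := eqVneq (dual_norm B s) 0.
  by rewrite !mulr_ge0 ?primal_norm_ge0// ltW.
have {}n0 : 0 < dual_norm B s by rewrite lt_neqAle eq_sym n0 dual_norm_ge0.
rewrite -(ler_pM2l n0) -expr2; apply: (le_trans h2).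
by rewrite -(ler_pM2r (_ : 0 < 4 * lambda)) ?mulr_gt0// in h1; lra.
Qed.

End PrimalDualNorms.

(** * Directional derivatives: mean values, symmetry, convexity *)

Section DirectionalDerivatives.
Context {R : realType} {V : normedModType R}.
Implicit Types (f g : V -> R^o) (x y h u v : V) (a b c d t : R).

Lemma is_derive_line f x h t : differentiable f (x + t *: h) ->
  is_derive t (1 : R) (fun r : R => f (x + r *: h) : R^o) ('D_h f (x + t *: h)).
Proof.
move=> df; have := @diff_derivable _ _ _ f _ h df.
rewrite /derivable /derive => cf.
have e : (fun r : R => r^-1 *: (((fun r : R => f (x + r *: h) : R^o) \o shift t)
    (r *: (1 : R^o)) - f (x + t *: h))) =
  (fun r : R => r^-1 *: ((f \o shift (x + t *: h)) (r *: h) - f (x + t *: h))).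
  apply/funext => r /=; congr (_ *: (f _ - _)).
  by rewrite [r *: _]mulr1 scalerDl addrCA.
by split; rewrite /derivable /derive e.
Qed.

Lemma mean_value_from0 (phi dphi : R -> R) t : 0 < t ->
  (forall t, is_derive t (1 : R) (phi : R -> R^o) (dphi t)) ->
  exists2 r, 0 < r < t & phi t - phi 0 = dphi r * t.
Proof.
move=> t0 h; have cphi : {within `[0, t], continuous phi}.
  by apply: derivable_within_continuous => r _; case: (h r).
have [r] := MVT t0 (fun r _ => h r) cphi.
by rewrite in_itv/= subr0; exists r.
Qed.

Lemma mean_value_unit (phi dphi : R -> R) :
  (forall t, is_derive t (1 : R) (phi : R -> R^o) (dphi t)) ->
  exists2 t, 0 < t < 1 & phi 1 - phi 0 = dphi t.
Proof.
by move=> /(mean_value_from0 ltr01)[t t01]; rewrite mulr1; exists t.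
Qed.

Lemma is_derive_quadratic a b t :
  is_derive t (1 : R) ((fun t : R => t * a + t ^+ 2 / 2 * b) : R -> R^o) (a + t * b).
Proof. by apply: is_derive_eq; rewrite /GRing.scale/=; field. Qed.

(** Subtract the linear and quadratic Taylor terms, apply the mean value theorem on [0, 1], then
    apply it to [dphi] on [0, t]. *)
Lemma mean_value_order2 (phi dphi ddphi : R -> R) :
  (forall t, is_derive t (1 : R) (phi : R -> R^o) (dphi t)) ->
  (forall t, is_derive t (1 : R) (dphi : R -> R^o) (ddphi t)) ->
  exists t r, [/\ 0 < t < 1, 0 < r < 1 &
    phi 1 - phi 0 - dphi 0 = ddphi 0 / 2 + t * (ddphi r - ddphi 0)].
Proof.
move=> h1 h2.
pose q t : R := t * dphi 0 + t ^+ 2 / 2 * ddphi 0.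
have h t : is_derive t (1 : R) (fun t => phi t - q t : R^o)
    (dphi t - (dphi 0 + t * ddphi 0)).
  by have hq := is_derive_quadratic (dphi 0) (ddphi 0) t; exact: is_deriveB.
have [t t01] := mean_value_unit h; have /andP[t0 t1] := t01.
have [r /andP[r0 rt] E2] := mean_value_from0 t0 h2.
rewrite /q => E1; exists t, r; split=> //; first by rewrite r0 (lt_trans rt t1).
by lra.
Qed.

Lemma mean_value_line f x h : (forall y, differentiable f y) ->
  exists2 t, 0 < t < 1 & f (x + h) - f x = 'D_h f (x + t *: h).
Proof.
move=> df.
have [t t01] := mean_value_unit (fun t => is_derive_line (df (x + t *: h))).
by rewrite scale1r scale0r addr0; exists t.
Qed.

Lemma deriveDdir f x u v : differentiable f x ->
  'D_(u + v) f x = 'D_u f x + 'D_v f x.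
Proof. by move=> df; rewrite !deriveE// linearD. Qed.

Lemma deriveZdir f x c u : differentiable f x -> 'D_(c *: u) f x = c * 'D_u f x.
Proof. by move=> df; rewrite !deriveE// linearZ. Qed.

Lemma derive_ge_of_slope (phi : R -> R) c d :
  is_derive (0 : R) (1 : R) (phi : R -> R^o) d ->
  (forall t, 0 < t < 1 -> c * t <= phi t - phi 0) -> c <= d.
Proof.
move=> [dphi <-] h.
have cv : r^-1 *: ((phi \o shift (0 : R)) (r *: (1 : R^o)) - phi 0) @[r --> 0^'+]
    --> 'D_1 (phi : R -> R^o) 0.
  by apply: cvg_dnbhs_at_right; exact: dphi.
apply: (cvgr_to_ge cv).
near=> t.
have t0 : 0 < t by [].
have t1 : t < 1 by near: t; exact: nbhs_right_lt.
rewrite /= addr0 [t *: (1 : R^o)]mulr1 [_ *: _]mulrC ler_pdivlMr//.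
by apply: h; rewrite t0 t1.
Unshelve. all: by end_near. Qed.

(** The mean value theorem along [u] turns the second difference into an increment of the derivative
    along [u], which differentiability at [x] linearises. *)
Lemma second_difference_bound f x u v : (forall y, differentiable f y) ->
  differentiable ('D_u f : V -> R^o) x -> forall e, 0 < e ->
  exists2 d, 0 < d & forall t, 0 < t < d ->
   `|f (x + t *: v + t *: u) - f (x + t *: v) - (f (x + t *: u) - f x)
     - t ^+ 2 * 'D_v ('D_u f) x| <= e * t ^+ 2.
Proof.
move=> df d2 e e0.
(* Bounds the total length 2|u| + |v| of the displacements [w1] and [w2] below, measured in units of
   t; the added 1 keeps [c] positive. *)
pose c : R := 2 * (`|u| + `|v|) + 1.
have c0 : 0 < c by rewrite ltr_wpDl// mulr_ge0// addr_ge0.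
have /eqaddoP/(_ (e / c)) := diff_locally d2.
rewrite divr_gt0// => /(_ isT)/nbhs_normP[d /= d0 hd].
have {}hd w : `|w| < d ->
    `|'D_u f (x + w) - 'D_u f x - 'D_w ('D_u f) x| <= e / c * `|w|.
  move=> wd; have := hd w; rewrite /ball_/= sub0r normrN => /(_ wd).
  by rewrite !fctE/= [w + x]addrC opprD addrA (deriveE w d2).
exists (d / c); first by rewrite divr_gt0.
move=> t /andP[t0]; rewrite ltr_pdivlMr// => tcd.
pose phi (r : R) : R := f (x + t *: v + r *: (t *: u)) - f (x + r *: (t *: u)).
pose dphi (r : R) : R := 'D_(t *: u) f (x + t *: v + r *: (t *: u))
  - 'D_(t *: u) f (x + r *: (t *: u)).
have hphi r : is_derive r (1 : R) (phi : R -> R^o) (dphi r).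
  have h1 := is_derive_line (df (x + t *: v + r *: (t *: u))).
  have h2 := is_derive_line (df (x + r *: (t *: u))).
  exact: is_deriveB.
have [r /andP[r0 r1]] := mean_value_unit hphi.
rewrite /phi /dphi !scale1r !scale0r !addr0 !deriveZdir// => E1.
have -> : f (x + t *: v + t *: u) - f (x + t *: v) - (f (x + t *: u) - f x) =
  f (x + t *: v + t *: u) - f (x + t *: u) - (f (x + t *: v) - f x) by ring.
rewrite E1.
set w1 := t *: v + r *: (t *: u); set w2 := r *: (t *: u).
have n2 : `|w2| <= t * `|u|.
  rewrite !normrZ !gtr0_norm// mulrA ler_wpM2r//.
  by rewrite -[leRHS]mul1r ler_pM2r// ltW.
have n1 : `|w1| <= t * (`|u| + `|v|).
  rewrite (le_trans (ler_normD _ _))// normrZ gtr0_norm// addrC mulrDr.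
  by rewrite lerD2r.
have cE : c = 2 * (`|u| + `|v|) + 1 by [].
have u0 := normr_ge0 u; have v0 := normr_ge0 v.
rewrite -(addrA x) -/w1.
have -> : t * 'D_u f (x + w1) - t * 'D_u f (x + w2) - t ^+ 2 * 'D_v ('D_u f) x =
  t * (('D_u f (x + w1) - 'D_u f x - 'D_w1 ('D_u f) x)
     - ('D_u f (x + w2) - 'D_u f x - 'D_w2 ('D_u f) x)).
  have e1 : 'D_w1 ('D_u f) x = t * 'D_v ('D_u f) x + 'D_w2 ('D_u f) x.
    by rewrite (deriveDdir _ _ d2) (deriveZdir _ _ d2).
  rewrite e1; move: ('D_w2 _ x) ('D_v _ x) ('D_u f _) ('D_u f _) ('D_u f _).
  by move=> *; ring.
rewrite normrM (gtr0_norm t0) expr2 mulrCA (ler_pM2l t0).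
apply: (le_trans (ler_normB _ _)).
have h1 : `|'D_u f (x + w1) - 'D_u f x - 'D_w1 ('D_u f) x| <=
  e / c * (t * (`|u| + `|v|)).
  have w1d : `|w1| < d by apply: le_lt_trans n1 _; apply: le_lt_trans tcd; rewrite ler_pM2l// cE; lra.
  apply: le_trans (hd w1 w1d) _.
  by rewrite ler_pM2l// divr_gt0.
have h2 : `|'D_u f (x + w2) - 'D_u f x - 'D_w2 ('D_u f) x| <=
  e / c * (t * `|u|).
  have w2d : `|w2| < d by apply: le_lt_trans n2 _; apply: le_lt_trans tcd; rewrite ler_pM2l// cE; lra.
  apply: le_trans (hd w2 w2d) _.
  by rewrite ler_pM2l// divr_gt0.
apply: le_trans (lerD h1 h2) _.
have ec : e / c * c = e by rewrite divfK ?gt_eqF.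
rewrite -mulrDr -[in leRHS]ec -[leRHS]mulrA ler_pM2l ?divr_gt0//.
by rewrite -mulrDr mulrC (ler_pM2r t0) cE; clear -u0 v0; lra.
Qed.

(** Young's theorem: the second difference is symmetric in [u] and [v], so for one small t both
    mixed derivatives, times t^2, approximate it within (e/2) t^2. *)
Lemma derive_comm f x u v : (forall y, differentiable f y) ->
  differentiable ('D_u f : V -> R^o) x -> differentiable ('D_v f : V -> R^o) x ->
  'D_v ('D_u f) x = 'D_u ('D_v f) x.
Proof.
move=> df du dv; apply/eqP; rewrite -subr_eq0 -normr_le0; apply/ler_addgt0Pl.
move=> e e0; rewrite addr0.
have key (p p0 p1 p2 a b T : R) : 0 < T ->
    `|p - p1 - (p2 - p0) - T * a| <= e / 2 * T ->
    `|p - p2 - (p1 - p0) - T * b| <= e / 2 * T -> `|a - b| <= e.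
  move=> T0; rewrite !ler_norml => /andP[h1 h2] /andP[h3 h4].
  have : T * (a - b) <= T * e by lra.
  have : T * (b - a) <= T * e by lra.
  by rewrite !ler_pM2l// => *; apply/andP; split; lra.
have e2 : 0 < e / 2 by rewrite divr_gt0.
have [d1 d10 h1] := second_difference_bound v df du e2.
have [d2 d20 h2] := second_difference_bound u df dv e2.
pose t : R := Num.min d1 d2 / 2.
have m0 : 0 < Num.min d1 d2 by rewrite lt_min d10.
have m1 : Num.min d1 d2 <= d1 by rewrite ge_min lexx.
have m2 : Num.min d1 d2 <= d2 by rewrite ge_min lexx orbT.
have t0 : 0 < t by rewrite divr_gt0.
have tm : t < Num.min d1 d2 by rewrite ltr_pdivrMr//; lra.
have := h1 t; rewrite t0 (lt_le_trans tm m1) => /(_ isT).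
have := h2 t; rewrite t0 (lt_le_trans tm m2) => /(_ isT).
have -> : x + t *: u + t *: v = x + t *: v + t *: u by exact: addrAC.
by move=> H1 H2; apply: (key _ _ _ _ _ _ _ _ H2 H1); rewrite exprn_gt0.
Qed.

Lemma convex_gradient_ineq f x y : (forall z, differentiable f z) ->
  convex_function [set: convex_lmodType V] f -> f x + 'D_(y - x) f x <= f y.
Proof.
move=> df cf.
have d1 : is_derive (0 : R) (1 : R) (fun r : R => - f (x + r *: (y - x)) : R^o)
    (- 'D_(y - x) f x).
  have := is_derive_line (df (x + (0 : R) *: (y - x))).
  by rewrite scale0r addr0 => h; exact: is_deriveN.
(* The slope lemma bounds derivatives from below, so the chord inequality is used for -f. *)
suff : - (f y - f x) <= - 'D_(y - x) f x by lra.
apply: (derive_ge_of_slope d1) => t /andP[t0 t1].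
rewrite scale0r addr0.
have t01 : 0 <= t <= 1 by rewrite !ltW.
have /(_ y x) := cf (Itv01 (ltW t0) (ltW t1)).
rewrite !inE => /(_ I I) /=.
rewrite convRE /conv/= /unstable.onem.
have -> : t *: y + (1 - t) *: x = x + t *: (y - x).
  by rewrite scalerBr scalerBl scale1r addrCA.
by lra.
Qed.

(** Adding the gradient inequalities at both endpoints makes the derivative along [h] nondecreasing
    in that direction, so its slopes are at least 0. *)
Lemma convex_second_derive_ge0 f x h : (forall z, differentiable f z) ->
  differentiable ('D_h f : V -> R^o) x ->
  convex_function [set: convex_lmodType V] f -> 0 <= 'D_h ('D_h f) x.
Proof.
move=> df d2 cf.
have := @is_derive_line ('D_h f) x h 0; rewrite scale0r addr0 => /(_ d2) d1.
apply: (derive_ge_of_slope d1) => t /andP[t0 t1].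
rewrite mul0r scale0r addr0.
have := convex_gradient_ineq x (x + t *: h) df cf.
have := convex_gradient_ineq (x + t *: h) x df cf.
have -> : x - (x + t *: h) = (- t) *: h by rewrite opprD addrA subrr add0r scaleNr.
have -> : x + t *: h - x = t *: h by rewrite addrAC subrr add0r.
rewrite !deriveZdir// => h1 h2.
by rewrite -(ler_pM2l t0); lra.
Qed.

End DirectionalDerivatives.

(** [linfun] accepts any function but computes as expected on linear ones; the linear structure is
    packed on the fly so that [lfunE] applies. *)
Lemma linfun_linearE (R : realType) (aT rT : vectType R) (g : aT -> rT) :
  linear g -> linfun g =1 g.
Proof.
move=> lg x.
pose L : {linear aT -> rT} := HB.pack g (GRing.isLinear.Build _ _ _ _ g lg).
exact: (lfunE L).
Qed.

(** * Forms of iterated derivatives, Holder constants, the Hessian *)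

Section IteratedDerivatives.
Context {R : realType} {E : finNormedModType R}.
Variable B : 'Hom(E, dual_space E).
Hypotheses (Bsym : self_adjoint B) (Bpos : positive_definite B).
Implicit Types (f : E -> R^o) (x y h u v : E) (p : nat) (nu t : R).

Lemma nabla_rcons hs h f : nabla (rcons hs h) f = nabla hs ('D_h f).
Proof. by elim: hs => //= h' hs ->. Qed.

Lemma differentiable_nabla p hs f x : times_differentiable p f ->
  (size hs < p)%N -> differentiable (nabla hs f) x.
Proof.
elim: p hs f => [//|p IH] hs f [df dDf].
case/lastP: hs => [|hs h]; first by move=> _; exact: df.
by rewrite size_rcons ltnS nabla_rcons; apply: IH; exact: dDf.
Qed.

(** Homogeneity in all slots at once. With [c] the norm and [e] the normalisation it reduces a form
    to directions in the unit ball, as [form_norm] demands. *)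
Lemma nablaZ p (c : E -> R) (e : E -> E) hs f x : times_differentiable p f ->
  (size hs <= p)%N ->
  nabla [seq c h *: e h | h <- hs] f x =
  (\prod_(h <- hs) c h) * nabla [seq e h | h <- hs] f x.
Proof.
move=> df; elim: hs x => [|h hs IH] x /= sp; first by rewrite big_nil mul1r.
have {}IH y := IH y (ltnW sp).
rewrite deriveZdir; last by apply: (differentiable_nabla _ df); rewrite size_map.
rewrite big_cons -mulrA; congr (_ * _).
have -> : nabla [seq c h *: e h | h <- hs] f =
    (\prod_(h <- hs) c h) *: (nabla [seq e h | h <- hs] f : E -> R^o).
  by apply/funext => y; rewrite IH.
rewrite deriveZ//; apply: diff_derivable.
by apply: (differentiable_nabla _ df); rewrite size_map.
Qed.

(** Zero directions give the form the value 0, so the supremum is at least 0. The order is positive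
    so that there is a direction to annihilate. *)
Lemma fine_smoothness_ge0 f p nu : 0 <= fine (smoothness_const B f p.+1 nu).
Proof.
rewrite /smoothness_const; case: asboolP => [df|//].
set S := [set _ | _ in _].
have [[[x y] xy]|noxy] := pselect (exists z : E * E, z.1 <> z.2); last first.
  (* On a trivial space the supremum of the empty set is -oo, which [fine] sends to 0. *)
  suff -> : S = set0 by rewrite ereal_sup0.
  by rewrite -subset0 => t [z zz]; exfalso; apply: noxy; exists z.
apply: fine_ge0; apply: ereal_sup_ge.
eexists; first by exists (x, y).
apply: mule_ge0; last by rewrite lee_fin invr_ge0 powR_ge0.
apply: ereal_sup_ge; exists 0%E => //; exists (nseq p.+1 0).
  split; first by rewrite size_nseq.
  by move=> u /nseqP[-> _]; rewrite /primal_norm linear0 sqrtr0 ler01.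
by rewrite /= !derive0 subrr.
Qed.

(** Normalise every direction and pull the norms out; a zero direction normalises to itself and
    stays in the unit ball. *)
Lemma nabla_holder_le f p nu hs x y : times_differentiable p f ->
  (smoothness_const B f p nu < +oo)%E -> size hs = p -> x <> y ->
  nabla hs f x - nabla hs f y <=
  fine (smoothness_const B f p nu) * primal_norm B (x - y) `^ nu
  * \prod_(h <- hs) primal_norm B h.
Proof.
move=> df; rewrite /smoothness_const asboolT//.
set S := [set _ | _ in _] => Soo hsp xy.
have xy0 : 0 < primal_norm B (x - y) `^ nu.
  by rewrite powR_gt0// primal_norm_gt0// subr_eq0; apply/eqP.
pose e h := (primal_norm B h)^-1 *: h.
have he : hs = [seq primal_norm B h *: e h | h <- hs].
  rewrite -[LHS]map_id; apply: eq_map => h.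
  have [->|h0] := eqVneq h 0; first by rewrite /e !scaler0.
  by rewrite /e scalerA divff ?scale1r// gt_eqF// primal_norm_gt0.
rewrite {1 2}he !(@nablaZ p (primal_norm B) e hs f _ df) ?hsp// -mulrBr mulrC.
apply: ler_wpM2r.
  by rewrite prodr_ge0// => h _; exact: primal_norm_ge0.
set es := map e hs; rewrite -ler_pdivrMr//.
set d := _ / _.
suff : (d%:E <= ereal_sup S)%E.
  by move: Soo; case: (ereal_sup S) => [r| |] //= _; rewrite lee_fin.
apply: ereal_sup_ge.
eexists; first by exists (x, y).
rewrite EFinM lee_wpmul2r ?lee_fin ?invr_ge0 ?powR_ge0//.
apply: ereal_sup_ge; exists (nabla es f x - nabla es f y)%:E => //.
exists es => //; split; first by rewrite size_map.
move=> u /mapP[h _ ->]; rewrite primal_normZ// ger0_norm ?invr_ge0 ?primal_norm_ge0//.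
have [->|h0] := eqVneq h 0.
  by rewrite /primal_norm linear0 sqrtr0 mulr0 ler01.
by rewrite mulVf// gt_eqF// primal_norm_gt0.
Qed.

Lemma normr_nabla_holder f p nu hs x y : times_differentiable p f ->
  (smoothness_const B f p nu < +oo)%E -> size hs = p -> x <> y ->
  `|nabla hs f y - nabla hs f x| <=
  fine (smoothness_const B f p nu) * primal_norm B (y - x) `^ nu
  * \prod_(h <- hs) primal_norm B h.
Proof.
move=> df Soo hsp xy; have yx : y <> x by move=> yx; exact: xy.
have e : primal_norm B (x - y) = primal_norm B (y - x).
  by rewrite -primal_normN opprB.
have := nabla_holder_le df Soo hsp xy; rewrite e.
have := nabla_holder_le df Soo hsp yx.
by rewrite ler_norml lerNl opprB => -> ->.
Qed.

Section TwiceDifferentiable.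
Variable f : E -> R^o.
Hypothesis df2 : times_differentiable 2 f.

Lemma gradE x u : grad f x u = 'D_u f x.
Proof.
have df := df2.1.
rewrite /grad linfun_linearE ?deriveE// => c v w.
by rewrite linearP.
Qed.

Lemma hess_linear_r x h : linear (fun v : E => nabla [:: h; v] f x).
Proof.
move=> c v w /=; have [df d2] := df2.
have -> : (fun x => 'D_(c *: v + w) f x) =
    c *: ('D_v f : E -> R^o) + ('D_w f : E -> R^o).
  by apply/funext => y; rewrite deriveDdir// deriveZdir.
have dv u : derivable ('D_u f : E -> R^o) x h by apply: diff_derivable; exact: (d2 u).1.
by rewrite deriveD ?deriveZ//; exact: derivableZ.
Qed.

Lemma hessE x h v : hess f x h v = 'D_h ('D_v f) x.
Proof.
have [L [-> LE]] : exists L : E -> dual_space E,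
    hess f x = linfun L /\ forall k u, L k u = 'D_k ('D_u f) x.
  by eexists; split=> // k u; exact: (linfun_linearE (@hess_linear_r x k)).
have lL : linear L.
  move=> c h1 h2; apply/lfunP => w.
  rewrite [RHS]add_lfunE [X in _ = X + _]scale_lfunE !LE.
  have d2 := (df2.2 w).1 x.
  by rewrite (deriveDdir _ _ d2) (deriveZdir _ _ d2).
by rewrite (linfun_linearE lL) LE.
Qed.

Lemma hess_sym x h v : hess f x h v = hess f x v h.
Proof. by rewrite !hessE; apply: derive_comm; [exact: df2.1|exact: (df2.2 _).1..]. Qed.

End TwiceDifferentiable.

End IteratedDerivatives.

(** * The Taylor remainder of the gradient and the threshold on lambda *)

Section NewtonRemainder.
Context {R : realType} {E : finNormedModType R}.
Variable B : 'Hom(E, dual_space E).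
Hypotheses (Bsym : self_adjoint B) (Bpos : positive_definite B).
Implicit Types (x y h u v : E) (nu t a : R).

Variable f : E -> R^o.
Hypothesis df2 : times_differentiable 2 f.
Hypothesis cf : convex_function [set: convex_lmodType E] f.

Lemma hess_ge0 x h : 0 <= hess f x h h.
Proof.
rewrite hessE//; apply: convex_second_derive_ge0 => //; first exact: df2.1.
exact: (df2.2 h).1.
Qed.

(** At a Newton trial point x + h, the subgradient F'(x + h) is this remainder minus lambda B h. *)
Definition taylor_rest x h : dual_space E := grad f (x + h) - grad f x - hess f x h.

Lemma taylor_restE x h u :
  taylor_rest x h u = 'D_u f (x + h) - 'D_u f x - 'D_h ('D_u f) x.
Proof.
by rewrite /taylor_rest !add_lfunE !opp_lfunE !gradE// hessE.
Qed.

Lemma taylor_rest0 x : taylor_rest x 0 = 0.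
Proof. by rewrite /taylor_rest addr0 subrr linear0 subrr. Qed.

Lemma primal_norm_line x h t : primal_norm B (x + t *: h - x) = `|t| * primal_norm B h.
Proof. by rewrite addrAC subrr add0r primal_normZ. Qed.

Lemma line_neq x h t : 0 < t -> h != 0 -> x <> x + t *: h.
Proof.
move=> t0 h0 e; have : x + t *: h - x = 0 by rewrite -e subrr.
rewrite addrAC subrr add0r => /eqP.
by rewrite scaler_eq0 gt_eqF//= (negbTE h0).
Qed.

Lemma powR_shrink t a nu : 0 <= nu -> 0 < t < 1 -> 0 <= a ->
  (`|t| * a) `^ nu <= a `^ nu.
Proof.
move=> nu0 /andP[t0 t1] a0; apply: ge0_ler_powR => //.
- by rewrite nnegrE mulr_ge0.
- by rewrite gtr0_norm// ler_piMl// ltW.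
Qed.

Lemma taylor_rest_le2 nu x h u : 0 <= nu ->
  (smoothness_const B f 2 nu < +oo)%E ->
  `|taylor_rest x h u| <= fine (smoothness_const B f 2 nu)
    * primal_norm B h `^ nu * primal_norm B h * primal_norm B u.
Proof.
move=> nu0 Soo.
have [->|h0] := eqVneq h 0.
  rewrite taylor_rest0 zero_lfunE normr0 !mulr_ge0 ?primal_norm_ge0 ?powR_ge0//.
  exact: fine_smoothness_ge0.
have [t t01] := mean_value_line x h (df2.2 u).1.
rewrite taylor_restE => ->.
have /andP[t0 t1] := t01.
have := @normr_nabla_holder _ _ _ Bpos f 2 nu [:: h; u] x (x + t *: h) df2 Soo erefl
  (line_neq t0 h0).
rewrite !big_cons big_nil mulr1 primal_norm_line => h1.
apply: (le_trans h1); rewrite mulrA.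
apply: ler_wpM2r; first exact: primal_norm_ge0.
apply: ler_wpM2r; first exact: primal_norm_ge0.
apply: ler_wpM2l; first exact: fine_smoothness_ge0.
by apply: powR_shrink => //; exact: primal_norm_ge0.
Qed.

Section ThirdOrder.
Variable nu : R.
Hypotheses (nu0 : 0 <= nu) (df3 : times_differentiable 3 f).
Hypothesis Soo : (smoothness_const B f 3 nu < +oo)%E.
Let L := fine (smoothness_const B f 3 nu).

(** By convexity the Hessian form along [h] is nonnegative at x + r u, where r |u| = t. Expanding it
    around [x] with the mean value theorem and the Holder bound on the third derivative, then
    multiplying by |u|, gives the claim. *)
Lemma third_derive_ge x h u t : 0 < t ->
  - (t * 'D_u ('D_h ('D_h f)) x) <=
  primal_norm B u * ('D_h ('D_h f) x + L * (t * t `^ nu) * primal_norm B h ^+ 2).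
Proof.
move=> t0; have L0 : 0 <= L := fine_smoothness_ge0 B f _ _.
have [->|u0] := eqVneq u 0.
  by rewrite derive0 mulr0 oppr0 /primal_norm linear0 sqrtr0 mul0r.
have nu_gt0 := primal_norm_gt0 Bpos u0.
have [r r0 rt] : exists2 r, 0 < r & r * primal_norm B u = t.
  by exists (t / primal_norm B u); rewrite ?divr_gt0// divfK// gt_eqF.
have dg : forall y, differentiable ('D_h ('D_h f) : E -> R^o) y.
  exact: ((df3.2 h).2 h).1.
have [c c01] := mean_value_line x (r *: u) dg.
have /andP[c0 c1] := c01.
rewrite (deriveZdir _ _ (dg _)) scalerA => E1.
have G0 : 0 <= 'D_h ('D_h f) (x + r *: u).
  by rewrite -hessE//; exact: hess_ge0.
have cr0 : 0 < c * r by rewrite mulr_gt0.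
have := @normr_nabla_holder _ _ _ Bpos f 3 nu [:: u; h; h] x (x + (c * r) *: u) df3 Soo erefl
  (line_neq cr0 u0).
rewrite !big_cons big_nil mulr1 primal_norm_line normrM (gtr0_norm r0).
rewrite -(mulrA `|c|) rt.
have ht : (`|c| * t) `^ nu <= t `^ nu by apply: powR_shrink => //; exact: ltW.
rewrite /= -/L ler_norml => /andP[_].
move: E1 G0 (primal_norm_ge0 B h) (powR_ge0 (`|c| * t) nu) ht.
set D2 := 'D_u _ _; set D1 := 'D_u _ _; set g0 := 'D_h _ x; set G := 'D_h _ _.
set pc := (_ * _) `^ _; set pt := t `^ nu; set b := primal_norm B h.
move: D1 D2 g0 G pc pt b (primal_norm B u) nu_gt0 rt.
move=> D1 D2 g0 G pc pt b n n0 <- E1 G0 b0 pc0 pcpt hD.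
have h1 : r * n * (D2 - D1) <= r * n * (L * pc * (n * (b * b))).
  by rewrite ler_wpM2l// mulr_ge0 ?ltW.
have h2 : L * pc * (r * n * n * (b * b)) <= L * pt * (r * n * n * (b * b)).
  apply: ler_wpM2r; last exact: ler_wpM2l.
  by rewrite !mulr_ge0 ?(ltW r0) ?(ltW n0).
have h3 : 0 <= n * G by rewrite mulr_ge0// ltW.
have h4 : n * G = n * g0 + r * n * D2 by rewrite mulrAC -E1; ring.
by rewrite expr2; lra.
Qed.

Lemma third_derive_le x h u t : 0 < t ->
  t * `|'D_u ('D_h ('D_h f)) x| <=
  primal_norm B u * ('D_h ('D_h f) x + L * (t * t `^ nu) * primal_norm B h ^+ 2).
Proof.
move=> t0; have h1 := third_derive_ge x h u t0; have h2 := third_derive_ge x h (- u) t0.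
have dN : 'D_(- u) ('D_h ('D_h f)) x = - 'D_u ('D_h ('D_h f)) x.
  by rewrite -scaleN1r (deriveZdir _ _ (((df3.2 h).2 h).1 x)) mulN1r.
move: h2; rewrite dN primal_normN mulrN opprK => h2.
by rewrite -{1}(gtr0_norm t0) -normrM ler_norml -lerNl h1 h2.
Qed.

(** Taylor expansion of the derivative along [u] leaves [u] innermost, whereas [third_derive_le] has
    it outermost. *)
Lemma third_derive_comm x h u :
  'D_h ('D_h ('D_u f)) x = 'D_u ('D_h ('D_h f)) x.
Proof.
have e : 'D_h ('D_u f) = 'D_u ('D_h f).
  by apply/funext => y; exact: (derive_comm df2.1 ((df2.2 u).1 y) ((df2.2 h).1 y)).
apply: (eq_trans (congr1 (fun g => 'D_h g x) e)).
exact: (derive_comm (df2.2 h).1 (((df3.2 h).2 u).1 x) (((df3.2 h).2 h).1 x)).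
Qed.

(** [mean_value_order2] for the derivative along [u] on the segment from x to x + h, then the Holder
    bound at the intermediate point. *)
Lemma taylor_rest_le3 x h u : 
  `|taylor_rest x h u| <= `|'D_h ('D_h ('D_u f)) x| / 2
    + L * primal_norm B h `^ nu * primal_norm B h ^+ 2 * primal_norm B u.
Proof.
have L0 : 0 <= L := fine_smoothness_ge0 B f _ _.
have [->|h0] := eqVneq h 0.
  rewrite taylor_rest0 zero_lfunE normr0 addr_ge0//.
  by rewrite !mulr_ge0 ?sqr_ge0 ?primal_norm_ge0 ?powR_ge0.
have dg := (df3.2 u).1; have dh := ((df3.2 u).2 h).1.
have [t [r [t01 r01]]] := mean_value_order2
  (fun t => is_derive_line (dg (x + t *: h)))
  (fun t => is_derive_line (dh (x + t *: h))).
rewrite scale1r !scale0r addr0 => E1.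
have /andP[r0 r1] := r01; have /andP[t0 t1] := t01.
have := @normr_nabla_holder _ _ _ Bpos f 3 nu [:: h; h; u] x (x + r *: h) df3 Soo
  erefl (line_neq r0 h0).
rewrite !big_cons big_nil mulr1 primal_norm_line /= -/L.
have := powR_shrink nu0 r01 (primal_norm_ge0 B h).
have := primal_norm_ge0 B u; have := primal_norm_ge0 B h.
rewrite (eq_trans (taylor_restE x h u) E1).
set e1 := 'D_h _ _; set e0 := 'D_h _ x.
set pc := (_ * _) `^ _; set pt := _ `^ _.
move: e1 e0 pc pt (primal_norm B h) (primal_norm B u).
move=> e1 e0 pc pt n m n0 m0 pcpt h1.
apply: (le_trans (ler_normD _ _)).
rewrite normrM (ger0_norm (_ : 0 <= 2^-1)) ?invr_ge0// lerD2l.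
rewrite normrM gtr0_norm//; apply: (@le_trans _ _ (1 * `|e1 - e0|)).
  by rewrite ler_wpM2r// ltW.
rewrite mul1r (le_trans h1)//.
have -> : L * pt * n ^+ 2 * m = L * pt * (n * (n * m)) by ring.
apply: ler_wpM2r; first by rewrite !mulr_ge0.
exact: ler_wpM2l.
Qed.

End ThirdOrder.

Lemma Mconst_ge0 q : 0 <= fine (Mconst B f q).
Proof. by rewrite /Mconst; case: ifP => _; exact: fine_smoothness_ge0. Qed.

(** Raise the hypothesis to the power q - 1 and divide by lambda^(q-2). *)
Lemma regularization_threshold (M g lambda q : R) : 0 <= M -> 0 < g -> 0 < lambda ->
  2 <= q -> (6 * M) `^ (q - 1)^-1 * g `^ ((q - 2) / (q - 1)) <= lambda ->
  6 * M * (g / lambda) `^ (q - 2) <= lambda.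
Proof.
move=> M0 g0 l0 q2 h; have q1 : 0 < q - 1 by lra.
have M6 : 0 <= 6 * M by rewrite mulr_ge0.
have := @ge0_ler_powR R (q - 1) (ltW q1) _ _ _ _ h.
rewrite !nnegrE mulr_ge0 ?powR_ge0// (ltW l0) => /(_ isT isT).
rewrite powRM ?powR_ge0// -!powRrM mulVf ?gt_eqF// powRr1// divfK ?gt_eqF//.
rewrite powRM ?invr_ge0 ?(ltW g0) ?(ltW l0)//.
have lp : 0 < lambda `^ (q - 2) by rewrite powR_gt0.
rewrite -(powR_inv1 (ltW l0)) -powRrM mulN1r powRN mulrA ler_pdivrMr//.
have -> : q - 1 = 1 + (q - 2) by lra.
rewrite (@powRD _ lambda 1 (q - 2)); last by rewrite (gt_eqF l0) implybT.
by rewrite (powRr1 (ltW l0)).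
Qed.

(** Here n = |h|, m = |u|, [G] is the Hessian form along h and [T] the size of the third derivative.
    With t = g/lambda, the term T/2 costs at most (lambda/2) n m and the Holder term at most
    (lambda/6) n m. *)
Lemma cubic_rest_threshold (q g lambda n m M G T : R) : 3 <= q ->
  0 < g -> 0 < lambda -> 0 <= n -> 0 <= m -> 0 <= M ->
  G + lambda * n ^+ 2 <= g * n -> n <= g / lambda ->
  6 * M * (g / lambda) `^ (q - 2) <= lambda ->
  g / lambda * T <=
    m * (G + M * (g / lambda * (g / lambda) `^ (q - 3)) * n ^+ 2) ->
  T / 2 + M * n `^ (q - 3) * n ^+ 2 * m <= lambda * n * m.
Proof.
move=> q3 g0 l0 n0 m0 M0 hG ngl hM hT.
have q20 : 0 < q - 2 by lra.
have mB t : 0 <= t -> t * t `^ (q - 3) = t `^ (q - 2).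
  by move=> t0; rewrite -(mulr_powRB1 t0 q20); congr (_ * powR _ _); lra.
have t0 : 0 < g / lambda by rewrite divr_gt0.
have npow : n `^ (q - 2) <= (g / lambda) `^ (q - 2).
  by apply: ge0_ler_powR => //; rewrite ?nnegrE ?(ltW q20) ?(ltW t0).
have gE : g = lambda * (g / lambda) by rewrite mulrC divfK ?gt_eqF.
rewrite (mB _ (ltW t0)) in hT.
have -> : M * n `^ (q - 3) * n ^+ 2 * m = M * n `^ (q - 2) * (n * m).
  by rewrite -(mB _ n0); ring.
move: hG hM hT t0 npow (powR_ge0 n (q - 2)); rewrite [X in _ <= X * n]gE.
move: (g / lambda) ((g / lambda) `^ _) (n `^ _) => t P Pn.
move=> hG hM hT t0 PnP Pn0.
have nm0 : 0 <= n * m by rewrite mulr_ge0.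
have MP0 : 0 <= M * P := mulr_ge0 M0 (le_trans Pn0 PnP).
have h3 : M * Pn * (n * m) <= lambda / 6 * (n * m).
  apply: ler_wpM2r => //; have := ler_wpM2l M0 PnP; lra.
have h4 : T <= lambda * n * m.
  rewrite -(ler_pM2l t0); apply: (le_trans hT).
  have -> : t * (lambda * n * m) = m * (lambda * t * n) by ring.
  apply: ler_wpM2l => //.
  have : M * P * n ^+ 2 <= lambda * n ^+ 2.
    by apply: ler_wpM2r; rewrite ?sqr_ge0//; lra.
  lra.
have : 0 <= lambda * (n * m) by rewrite mulr_ge0// ltW.
by lra.
Qed.

(** The displacement inequality and convexity give |h| <= g/lambda. For q < 3 the Holder bound on
    the Hessian is enough; for q >= 3 the third derivative is absorbed with t = g/lambda. *)
Lemma dual_norm_taylor_rest_le q x h g lambda : 2 <= q <= 4 ->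
  (Mconst B f q < +oo)%E -> 0 < g -> 0 < lambda ->
  hess f x h h + lambda * primal_norm B h ^+ 2 <= g * primal_norm B h ->
  (6 * fine (Mconst B f q)) `^ (q - 1)^-1 * g `^ ((q - 2) / (q - 1)) <= lambda ->
  dual_norm B (taylor_rest x h) <= lambda * primal_norm B h.
Proof.
move=> /andP[q2 q4] Moo g0 l0 hh hM.
have := regularization_threshold (Mconst_ge0 q) g0 l0 q2 hM.
set M := fine _ => {}hM.
have M0 : 0 <= M := Mconst_ge0 q.
have G0 := hess_ge0 x h.
have n0 := primal_norm_ge0 B h.
apply: dual_norm_le => //; first by rewrite mulr_ge0// ltW.
move=> u; have m0 := primal_norm_ge0 B u.
have ln : lambda * primal_norm B h <= g.
  have [->|nn0] := eqVneq (primal_norm B h) 0; first by rewrite mulr0 ltW.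
  have {}nn0 : 0 < primal_norm B h by rewrite lt_neqAle eq_sym nn0.
  by rewrite -(ler_pM2r nn0); move: hh; rewrite expr2 mulrA; lra.
have ngl : primal_norm B h <= g / lambda by rewrite ler_pdivlMr// mulrC.
have npow : primal_norm B h `^ (q - 2) <= (g / lambda) `^ (q - 2).
  by apply: ge0_ler_powR => //; rewrite ?nnegrE ?divr_ge0 ?(ltW g0) ?(ltW l0)//; lra.
move: Moo M0 hM; rewrite /M /Mconst; case: ifPn => q3 Moo M0 hM.
  have q20 : 0 <= q - 2 by lra.
  apply: (le_trans (taylor_rest_le2 _ _ _ q20 Moo)).
  apply: ler_wpM2r => //; apply: ler_wpM2r => //.
  by have := ler_wpM2l M0 npow; have := mulr_ge0 M0 (powR_ge0 (g / lambda) (q - 2)); lra.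
have {}q3 : 3 <= q by rewrite leNgt.
have q30 : 0 <= q - 3 by lra.
have df3 : times_differentiable 3 f.
  by move: Moo; rewrite /smoothness_const; case: asboolP.
have gl0 : 0 < g / lambda by rewrite divr_gt0.
have h1 := taylor_rest_le3 q30 df3 Moo x h u.
have h2 := third_derive_le q30 df3 Moo x h u gl0.
rewrite -(third_derive_comm df3) -(hessE df2) in h2.
apply: (le_trans h1).
exact: (cubic_rest_threshold q3 g0 l0 n0 m0 M0 hh ngl hM h2).
Qed.

End NewtonRemainder.

(** * One Newton step: optimality, acceptance, update of [H] *)

Section NewtonStep.
Context {R : realType} {E : finNormedModType R}.
Variables (B : 'Hom(E, dual_space E)) (f : E -> R^o) (psi : E -> \bar R).
Hypotheses (Bsym : self_adjoint B) (Bpos : positive_definite B).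
Hypotheses (cf : convex_function [set: convex_lmodType E] f)
  (df2 : times_differentiable 2 f) (ppsi : eproper psi) (cpsi : econvex psi).
Implicit Types (x y z h : E) (s : dual_space E) (lambda g t : R).

Lemma dual_subE s s' h : (s - s') h = s h - s' h.
Proof. by rewrite add_lfunE opp_lfunE. Qed.

Lemma dual_addE s s' h : (s + s') h = s h + s' h.
Proof. by rewrite add_lfunE. Qed.

Lemma dual_scaleE s (w : E) t : s (t *: w) = t * s w.
Proof. by rewrite linearZ. Qed.

Lemma dual_lineE s (d w : E) t : s (d + t *: w) = s d + t * s w.
Proof. by rewrite linearD linearZ. Qed.

Lemma newton_subgradE x lambda y v : newton_subgrad B f x lambda y v =
  - grad f x v - hess f x (y - x) v - lambda * B (y - x) v.
Proof.
by rewrite /newton_subgrad !dual_subE opp_lfunE scale_lfunE.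
Qed.

Lemma sqr_primal_norm_line (d w : E) t :
  primal_norm B (d + t *: w) ^+ 2 =
  primal_norm B d ^+ 2 + 2 * t * B d w + t ^+ 2 * primal_norm B w ^+ 2.
Proof.
rewrite !sqr_primal_norm// formD !formDr !formZ !formZr (Bsym w d).
by move: (B d d) (B d w) (B w w) => a b c; ring.
Qed.

Lemma hess_line x (d w : E) t :
  hess f x (d + t *: w) (d + t *: w) =
  hess f x d d + 2 * t * hess f x d w + t ^+ 2 * hess f x w w.
Proof.
have -> : hess f x (d + t *: w) = hess f x d + t *: hess f x w.
  by rewrite linearD linearZ.
rewrite dual_lineE !dual_addE !scale_lfunE (hess_sym df2 x w d).
rewrite /GRing.scale/=.
by move: (hess f x d d) (hess f x d w) (hess f x w w) => a b c; ring.
Qed.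

Lemma slope_ge0_of_quadratic (a c : R) :
  (forall t, 0 < t <= 1 -> 0 <= t * a + t ^+ 2 * c) -> 0 <= a.
Proof.
move=> h; rewrite leNgt; apply/negP => a0.
(* Positive because a < 0, and small enough that t |c| < -a/2. *)
pose t : R := Num.min 1 (- a / (2 * (`|c| + 1))).
have c0 : 0 < 2 * (`|c| + 1) by rewrite mulr_gt0// ltr_wpDl.
have t0 : 0 < t by rewrite lt_min ltr01 divr_gt0// oppr_gt0.
have t1 : t <= 1 by rewrite ge_min lexx.
have t2 : t <= - a / (2 * (`|c| + 1)) by rewrite ge_min lexx orbT.
have := h t; rewrite t0 t1 => /(_ isT).
rewrite expr2 -mulrA -mulrDr pmulr_rge0// => h1.
rewrite ler_pdivlMr// in t2.
have : t * c <= t * `|c| by rewrite ler_pM2l// ler_norm.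
by lra.
Qed.

(** First-order optimality: moving from [y] towards [z] by a fraction t, convexity of [psi] leaves t
    a + t^2 c >= 0 for t in (0, 1], hence a >= 0. *)
Lemma argmin_subgrad x lambda y : is_argmin (newton_model B f psi x lambda) y ->
  subdifferential psi y (newton_subgrad B f x lambda y).
Proof.
move=> ymin; have [npsi [x0 px0]] := ppsi.
have py : psi y \is a fin_num.
  rewrite fin_numE npsi/=; apply/negP => /eqP py.
  have := ymin x0; rewrite /newton_model py addey//= leye_eq => /eqP h.
  by move: px0; rewrite /edom/=; move: h; case: (psi x0).
split=> // z; have [pz|] := boolP (psi z \is a fin_num); last first.
  rewrite fin_numE npsi/= negbK => /eqP ->; exact: leey.
rewrite -(fineK py) -(fineK pz) -EFinD lee_fin.
set a := fine (psi y); set b := fine (psi z).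
set d := y - x; set w := z - y.
suff : 0 <= b - a + grad f x w + hess f x d w + lambda * B d w.
  by rewrite newton_subgradE -/d -/w; move=> h; lra.
apply: (@slope_ge0_of_quadratic _
  (hess f x w w / 2 + lambda / 2 * primal_norm B w ^+ 2)) => t /andP[t0 t1].
have := ymin (y + t *: w).
rewrite /newton_model.
have -> : y + t *: w - x = d + t *: w by rewrite /d addrAC.
have yw : y + t *: w = t *: z + (1 - t) *: y.
  by rewrite /w scalerBr scalerBl scale1r addrCA.
have t01 : 0 <= t <= 1 by rewrite (ltW t0).
have := cpsi z y t01; rewrite -yw -(fineK py) -(fineK pz) -/a -/b.
move=> h1 h2; have := le_trans h2 (leeD2l _ h1).
rewrite -!EFinM -!EFinD lee_fin sqr_primal_norm_line hess_line.
rewrite dual_lineE -/d {h1 h2}.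
move: (grad f x d) (grad f x w) (hess f x d d) (hess f x d w) (hess f x w w).
move: (primal_norm B d ^+ 2) (primal_norm B w ^+ 2) (B d w) a b => *.
lra.
Qed.

Lemma subgrad_monotone (phi : E -> \bar R) x y s s' :
  subdifferential phi x s -> subdifferential phi y s' -> s (y - x) <= s' (y - x).
Proof.
move=> [fx hx] [fy hy]; have := hx y; have := hy x.
rewrite -(fineK fx) -(fineK fy) -!EFinD !lee_fin -(opprB y x) linearN/=; lra.
Qed.

(** Monotonicity of the subdifferential of [psi] between [x] and [y], then Cauchy-Schwarz for
    F'(x). *)
Lemma newton_displacement x s lambda y : subdifferential psi x s ->
  subdifferential psi y (newton_subgrad B f x lambda y) ->
  hess f x (y - x) (y - x) + lambda * primal_norm B (y - x) ^+ 2
    <= dual_norm B (grad f x + s) * primal_norm B (y - x).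
Proof.
move=> hs hs'; have := subgrad_monotone hs hs'.
rewrite newton_subgradE sqr_primal_norm//.
have := ler_dual_pairing Bsym Bpos (grad f x + s) (y - x).
rewrite dual_addE ler_norml => /andP[+ _].
move: (hess f x (y - x) _) (B _ _) (grad f x _) (s _) (dual_norm _ _ * _) => *.
lra.
Qed.

(** Read contrapositively: a rejected lambda lies below the threshold, which limits the
    backtracking. *)
Lemma newton_accept_of_large x s lambda y q : subdifferential psi x s ->
  is_argmin (newton_model B f psi x lambda) y ->
  2 <= q <= 4 -> (Mconst B f q < +oo)%E ->
  0 < dual_norm B (grad f x + s) -> 0 < lambda ->
  (6 * fine (Mconst B f q)) `^ (q - 1)^-1
    * dual_norm B (grad f x + s) `^ ((q - 2) / (q - 1)) <= lambda ->
  newton_accept B f x lambda y.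
Proof.
move=> hs /argmin_subgrad hs' q24 Moo g0 l0 hl.
have hh := newton_displacement hs hs'.
have hw := dual_norm_taylor_rest_le Bsym Bpos df2 cf q24 Moo g0 l0 hh hl.
rewrite /newton_accept -opprB.
apply: (dual_pairing_ge_of_remainder Bsym Bpos l0 _ hw).
have xy : x + (y - x) = y by rewrite addrC subrK.
by rewrite /taylor_rest xy /newton_subgrad !addrA.
Qed.

(** The bound on [H] is a loop invariant: the accepted lambda is at most 4 C g^theta, the division
    by 4 in the update gains a factor 4, and passing from g to g' <= 4 g costs at most that
    factor. *)
Lemma newton_step_spec alpha q C x s H x' s' H' :
  2 <= q <= 4 -> (Mconst B f q < +oo)%E -> 2 / 3 <= alpha <= 1 ->
  C = (6 * fine (Mconst B f q)) `^ (q - 1)^-1 ->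
  let theta := (q - 2) / (q - 1) in
  let g := dual_norm B (grad f x + s) in
  let g' := dual_norm B (grad f x' + s') in
  subdifferential psi x s -> 0 < g -> 0 < H ->
  H <= 4 * C * g `^ (theta - alpha) ->
  newton_step B f psi alpha x s H x' s' H' ->
  [/\ subdifferential psi x' s', 0 < H',
    0 < g' -> H' <= 4 * C * g' `^ (theta - alpha) &
    g' ^+ 2 <= 16 * C * g `^ theta * (grad f x' + s') (x - x')].
Proof.
move=> q24 Moo /andP[al au] CE theta g g' hs g0 H0 HC.
move=> [j [T [hT [hrej [hacc [xE [sE HE]]]]]]].
have /andP[q2 q4] := q24; have q1 : 0 < q - 1 by lra.
have C0 : 0 <= C by rewrite CE powR_ge0.
have ga0 : 0 < g `^ alpha by rewrite powR_gt0.
have gt0 : 0 < g `^ theta by rewrite powR_gt0.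
have gE : g `^ theta = g `^ (theta - alpha) * g `^ alpha.
  by rewrite -powRD ?subrK// (gt_eqF g0) implybT.
pose lj := 4 ^+ j * H * g `^ alpha.
have lam0 i : 0 < 4 ^+ i * H * g `^ alpha by rewrite !mulr_gt0 ?exprn_gt0.
have lj0 : 0 < lj := lam0 j.
(* For j = 0 this is the bound on [H]; otherwise trial j - 1 was rejected, so its lambda was below C
   g^theta. *)
have ljC : lj <= 4 * (C * g `^ theta).
  rewrite /lj; case: (j) hrej hT => [|i] hrej hT.
    by rewrite expr0 mul1r gE !mulrA ler_pM2r.
  rewrite exprS -!mulrA ler_pM2l// leNgt; apply/negP => hC.
  apply: (hrej i (ltnSn i)); have := hT i (leqnSn i) => hTi.
  apply: (newton_accept_of_large hs hTi q24 Moo g0); first exact: lam0.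
  by rewrite -CE ltW// -mulrA.
rewrite -/g -/lj in hT hrej hacc xE sE HE.
have hTj := hT j (leqnn j).
have hs' : subdifferential psi x' s' by rewrite xE sE; exact: argmin_subgrad hTj.
have h4 : (4 * lj)^-1 * g' ^+ 2 <= (grad f x' + s') (x - x').
  by rewrite /g' xE sE; exact: hacc.
have hdisp : lj * primal_norm B (x' - x) ^+ 2 <= g * primal_norm B (x' - x).
  have := newton_displacement hs (argmin_subgrad hTj); rewrite -xE.
  by apply: le_trans; rewrite lerDr; exact: hess_ge0.
have g'0 : 0 <= g' := dual_norm_ge0 _ _.
have HE' : H' * g `^ alpha = lj / 4 by rewrite HE /lj; field.
have H'0 : 0 < H' by rewrite HE !mulr_gt0 ?exprn_gt0 ?invr_gt0.
split; [exact: hs'|exact: H'0| |].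
- move=> g'p.
  have g4 : g' <= 4 * g.
    have h4' : (4 * lj)^-1 * g' ^+ 2 <= (grad f x' + s') (- (x' - x)).
      by rewrite opprB.
    have := dual_norm_le_of_accept Bsym Bpos lj0 h4'; rewrite -/g' => /le_trans; apply.
    rewrite ler_pM2l//.
    set r := primal_norm B (x' - x).
    have r0 : 0 <= r := primal_norm_ge0 _ _.
    have [->|rn0] := eqVneq r 0; first by rewrite mulr0 ltW.
    have {}rn0 : 0 < r by rewrite lt_neqAle eq_sym rn0.
    by rewrite -(ler_pM2r rn0) -mulrA -expr2.
  have Hg : H' <= C * g `^ (theta - alpha).
    by rewrite -(ler_pM2r ga0) HE' -[leRHS]mulrA -gE; lra.
  (* q <= 4 gives theta <= 2/3 <= alpha. As alpha <= 1 and theta >= 0, the exponent alpha - theta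
     lies in [0, 1], and so 4^(alpha - theta) <= 4. *)
  have d0 : 0 <= alpha - theta.
    rewrite subr_ge0 (le_trans _ al)// /theta ler_pdivrMr//; lra.
  have th0 : 0 <= theta by rewrite divr_ge0//; lra.
  have hp : g `^ (theta - alpha) <= 4 * g' `^ (theta - alpha).
    rewrite -(opprB alpha) !powRN.
    have g'a : 0 < g' `^ (alpha - theta) by rewrite powR_gt0.
    have gaa : 0 < g `^ (alpha - theta) by rewrite powR_gt0.
    rewrite ler_pdivlMr// mulrC ler_pdivrMr//.
    have : g' `^ (alpha - theta) <= (4 * g) `^ (alpha - theta).
      by apply: ge0_ler_powR => //; rewrite nnegrE ?mulr_ge0 ?(ltW g0).
    move=> /le_trans; apply; rewrite powRM ?(ltW g0)// ler_pM2r//.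
    by rewrite -[leRHS](@powRr1 _ 4)// ler_powR ?ler1n//; lra.
  apply: (le_trans Hg); rewrite (mulrC 4) -mulrA.
  by apply: ler_wpM2l.
- rewrite ler_pdivrMl ?mulr_gt0// in h4.
  have acc0 : 0 <= (grad f x' + s') (x - x').
    by rewrite -(pmulr_rge0 _ (_ : 0 < 4 * lj)) ?mulr_gt0// (le_trans _ h4)// sqr_ge0.
  apply: (le_trans h4); apply: ler_wpM2r => //.
  by rewrite -mulrA; lra.
Qed.

End NewtonStep.

(** * Level set: residuals, relative size, uniform convexity *)

Section LevelSet.
Context {R : realType} {E : finNormedModType R}.
Variables (B : 'Hom(E, dual_space E)) (f : E -> R^o) (psi : E -> \bar R).
Hypotheses (Bsym : self_adjoint B) (Bpos : positive_definite B).
Hypotheses (cf : convex_function [set: convex_lmodType E] f)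
  (df2 : times_differentiable 2 f) (ppsi : eproper psi) (cpsi : econvex psi).
Variable (x0 : E).
Implicit Types (x y z h : E) (s : dual_space E) (g t c : R).

Notation F := (objective f psi).
Notation level := (level_set f psi x0).
Notation Fr := (fun x => fine (objective f psi x)).

Lemma edom_fin_num x : edom psi x -> psi x \is a fin_num.
Proof. by move=> px; rewrite fin_numE ppsi.1/= lt_eqF. Qed.

Lemma objective_fin_num x : edom psi x -> F x \is a fin_num.
Proof. by move=> /edom_fin_num px; rewrite fin_numD px. Qed.

Lemma level_fin_num x : level x -> F x \is a fin_num.
Proof. by move=> [/objective_fin_num]. Qed.

Lemma fine_objective x : edom psi x -> fine (F x) = f x + fine (psi x).
Proof. by move=> /edom_fin_num px; rewrite /objective fineD. Qed.

Lemma objective_subgrad x s : subdifferential psi x s ->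
  subdifferential F x (grad f x + s).
Proof.
move=> [px hs]; split; first by rewrite fin_numD px.
move=> y; have := hs y; rewrite /objective -(fineK px).
have hf := convex_gradient_ineq x y df2.1 cf.
case: (psi y) (ppsi.1 y) => [b _| _ _|] //; last by rewrite addey// leey.
rewrite -!EFinD !lee_fin dual_addE gradE//.
by move: (s _) ('D__ _ _) hf => u v; lra.
Qed.

Lemma subgrad_le x y s : subdifferential F x s -> F y \is a fin_num ->
  fine (F x) + s (y - x) <= fine (F y).
Proof. by move=> [Fx hs] Fy; have := hs y; rewrite -(fineK Fx) -(fineK Fy) -EFinD lee_fin. Qed.

Lemma level_segment y z t : level y -> level z -> 0 <= t <= 1 ->
  level (z + t *: (y - z)).
Proof.
move=> [py hy] [pz hz] t01; have /andP[t0 t1] := t01.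
have yz : z + t *: (y - z) = t *: y + (1 - t) *: z.
  by rewrite scalerBr scalerBl scale1r addrCA.
have := cpsi y z t01; rewrite -yz.
have := cf (Itv01 t0 t1); move=> /(_ y z); rewrite !inE => /(_ I I).
rewrite convRE /conv/= /unstable.onem -yz => hf.
rewrite -(fineK (edom_fin_num py)) -(fineK (edom_fin_num pz)) -!EFinM -EFinD => hp.
have pyz : edom psi (z + t *: (y - z)) by apply: le_lt_trans hp _; exact: ltry.
split=> //; have x0fin : F x0 != -oo%E.
  by rewrite /objective; case: (psi x0) (ppsi.1 x0) => [r| |].
have [->|x0y] := eqVneq (F x0) +oo%E; first exact: leey.
have x0f : F x0 \is a fin_num by rewrite fin_numE x0fin.
move: hy hz hp.
rewrite -(fineK (objective_fin_num py)) -(fineK (objective_fin_num pz)).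
rewrite -(fineK (objective_fin_num pyz)) -(fineK x0f) -(fineK (edom_fin_num pyz)) !lee_fin.
move: (fine (F x0)) => a; rewrite !fine_objective//.
set w := _ + _ *: _ in hf *.
move: (f y) (f z) (f w) hf (fine (psi y)) (fine (psi z)) (fine (psi w)).
move=> fy fz fw hf sy sz sw h1 h2 h3.
have e1 : t * (fy + sy) <= t * a by rewrite ler_wpM2l.
have e2 : (1 - t) * (fz + sz) <= (1 - t) * a by rewrite ler_wpM2l// subr_ge0.
lra.
Qed.

(** Points of the domain outside the level set have a larger objective than [z], so gaps to level
    points control the infimum. The bound is stated in the extended reals because it serves to prove
    [opt_value] finite. *)
Lemma residual_le z c : level z ->
  (forall y, level y -> fine (F z) - fine (F y) <= c) ->
  (residual f psi z <= c%:E)%E.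
Proof.
move=> lz h; have c0 : 0 <= c by have := h z lz; rewrite subrr.
have Fz := level_fin_num lz.
have : ((fine (F z) - c)%:E <= opt_value f psi)%E.
  apply: le_ereal_inf_tmp => _ [y py <-].
  have Fy := objective_fin_num py; rewrite -(fineK Fy) lee_fin.
  have [yx0|yx0] := leP (F y) (F x0).
    by have := h y (conj py yx0); lra.
  have := le_lt_trans lz.2 yx0; rewrite -(fineK Fz) -(fineK Fy) lte_fin/=.
  by lra.
rewrite /residual -{2}(fineK Fz); case: (opt_value f psi) => [v| |] //=; last first.
  by rewrite addeNy leNye.
by rewrite -EFinB !lee_fin; lra.
Qed.

Lemma opt_value_fin_num z c : level z -> (residual f psi z <= c%:E)%E ->
  opt_value f psi \is a fin_num.
Proof.
move=> lz; rewrite fin_numE; have Fz := level_fin_num lz.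
have : (opt_value f psi <= F z)%E by apply: ereal_inf_lbound; exists z => //; exact: lz.1.
rewrite /residual -(fineK Fz); case: (opt_value f psi) => [v| |] //=.
Qed.

Section Sizes.
Variable G : E -> dual_space E.
Hypothesis strictF : strictly_econvex F.
Hypothesis nontrivial : exists y z, [/\ level y, level z & y <> z].
Hypothesis diam_fin : (level_diam B f psi x0 < +oo)%E.
Hypothesis subG : forall y, level y -> subdifferential F y (G y).
Hypothesis V_fin : (VF f psi G x0 < +oo)%E.
Let D := fine (level_diam B f psi x0).
Let V := fine (VF f psi G x0).

Lemma primal_norm_diam_le y z : level y -> level z -> primal_norm B (y - z) <= D.
Proof.
move=> ly lz.
have : ((primal_norm B (y - z))%:E <= level_diam B f psi x0)%E.
  by apply: ereal_sup_ubound; exists (y, z).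
by move: diam_fin; rewrite /D; case: (level_diam _ _ _ _).
Qed.

Lemma betaF_le y z : level y -> level z -> betaF G y z <= V.
Proof.
move=> ly lz; have : ((betaF G y z)%:E <= VF f psi G x0)%E.
  by apply: ereal_sup_ubound; exists (y, z).
by move: V_fin; rewrite /V; case: (VF _ _ _ _).
Qed.

(** The subgradient inequalities at [y] and [z], both evaluated at the midpoint, are added and
    compared with strict convexity there. *)
Lemma betaF_gt0 y z : level y -> level z -> y <> z -> 0 < betaF G y z.
Proof.
move=> ly lz yz; have h01 : 0 < (2^-1 : R) < 1 by apply/andP; split; lra.
have yz' : y != z by apply/eqP.
have Fdom w : level w -> edom F w.
  by move=> lw; rewrite /edom/= -(fineK (level_fin_num lw)) ltry.
have := strictF (Fdom _ ly) (Fdom _ lz) yz' h01.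
set m := _ + _; rewrite -(fineK (level_fin_num ly)) -(fineK (level_fin_num lz)).
rewrite -!EFinM -EFinD => hm.
have mE : m = z + 2^-1 *: (y - z).
  by rewrite /m scalerBr scalerBl scale1r addrCA.
have mz : m - z = 2^-1 *: (y - z) by rewrite mE addrAC subrr add0r.
have my : m - y = (- 2^-1) *: (y - z).
  have -> : m - y = (m - z) - (y - z) by rewrite opprB addrA subrK.
  rewrite mz -[X in _ - X]scale1r -scalerBl; congr (_ *: _); lra.
have h1 := (subG ly).2 m; have h2 := (subG lz).2 m.
have mfin : F m \is a fin_num.
  have Fm : (F m < +oo)%E by apply: lt_trans hm _; exact: ltry.
  rewrite fin_numE (lt_eqF Fm) andbT.
  by apply/negP => /eqP h; move: h1; rewrite h -(fineK (level_fin_num ly)).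
rewrite -(fineK mfin) in hm h1 h2; rewrite lte_fin in hm.
rewrite -(fineK (level_fin_num ly)) in h1; rewrite -(fineK (level_fin_num lz)) in h2.
rewrite -EFinD lee_fin my dual_scaleE in h1; rewrite -EFinD lee_fin mz dual_scaleE in h2.
rewrite /betaF dual_subE.
move: (G y _) (G z _) h1 h2 => u v; lra.
Qed.

Lemma VF_gt0 : 0 < V.
Proof.
have [y [z [ly lz yz]]] := nontrivial.
exact: lt_le_trans (betaF_gt0 ly lz yz) (betaF_le ly lz).
Qed.

(** Serves twice: with the diameter for the logarithmic term, and with D_s when s = +oo. *)
Lemma gap_le_linear y z s d : subdifferential F z s -> level y -> level z ->
  primal_norm B (y - z) <= d -> fine (F z) - fine (F y) <= dual_norm B s * d.
Proof.
move=> hs ly lz hd; have := subgrad_le hs (level_fin_num ly).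
have := ler_dual_pairing Bsym Bpos s (y - z).
have := ler_wpM2l (dual_norm_ge0 B s) hd.
by rewrite ler_norml => h1 /andP[h2 _]; lra.
Qed.

Section RelativeSize.
Variable r : \bar R.
Hypothesis Ds_fin : (relative_size B f psi G x0 r < +oo)%E.
Let Ds := fine (relative_size B f psi G x0 r).

Lemma relative_size_le y z : level y -> level z -> y <> z ->
  primal_norm B (y - z) * (betaF G y z / V) `^ (- inv_size r) <= Ds.
Proof.
move=> ly lz yz; set a := _ * _.
have : (a%:E <= relative_size B f psi G x0 r)%E.
  by apply: ereal_sup_ubound; exists (y, z).
by move: Ds_fin; rewrite /Ds; case: (relative_size _ _ _ _ _ _).
Qed.

Lemma relative_size_gt0 : 0 < Ds.
Proof.
have [y [z [ly lz yz]]] := nontrivial.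
apply: lt_le_trans (relative_size_le ly lz yz).
rewrite mulr_gt0 ?powR_gt0 ?divr_gt0 ?betaF_gt0 ?VF_gt0//.
by rewrite primal_norm_gt0// subr_eq0; apply/eqP.
Qed.

End RelativeSize.

Section FiniteOrder.
Variable r : R.
Hypothesis r1 : 1 < r.
Hypothesis Ds_fin : (relative_size B f psi G x0 r%:E < +oo)%E.
Let Ds := fine (relative_size B f psi G x0 r%:E).

Lemma betaF_ge y z : level y -> level z -> y <> z ->
  V * (primal_norm B (y - z) / Ds) `^ r <= betaF G y z.
Proof.
move=> ly lz yz; have := relative_size_le Ds_fin ly lz yz.
have V0 := VF_gt0; have b0 := betaF_gt0 ly lz yz.
have D0 := relative_size_gt0 Ds_fin.
have r0 : 0 < r := lt_trans ltr01 r1.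
have xi0 : 0 < betaF G y z / V by rewrite divr_gt0.
rewrite /inv_size -/Ds powRN ler_pdivrMr ?powR_gt0// => h.
rewrite mulrC -ler_pdivlMr// -[leRHS]powRr1 ?(ltW xi0)// -(mulVf (lt0r_neq0 r0)).
rewrite powRrM; apply: ge0_ler_powR.
- exact: ltW.
- by rewrite nnegrE divr_ge0 ?primal_norm_ge0 ?(ltW D0).
- by rewrite nnegrE powR_ge0.
- by rewrite ler_pdivrMr// mulrC.
Qed.

(** On the segment from [z] to [y], dividing the lower bound on [betaF] by t - u leaves the power r
    - 1, so [uniformly_convex_segment] applies with c = V (|y - z|/D_s)^r. The subgradient [s] at
    [z] is arbitrary and may differ from [G z]. *)
Lemma uniform_convexity y z s : subdifferential F z s -> level y -> level z ->
  fine (F z) + s (y - z) + V * (primal_norm B (y - z) / Ds) `^ r / r <= fine (F y).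
Proof.
move=> hs ly lz; have r0 : 0 < r := lt_trans ltr01 r1.
have V0 := VF_gt0; have D0 := relative_size_gt0 Ds_fin.
have [->|yz] := eqVneq y z.
  rewrite subrr linear0 {1}/primal_norm !linear0 sqrtr0 mul0r powR0 ?gt_eqF//.
  by rewrite mulr0 mul0r !addr0.
pose w t := z + t *: (y - z).
have lw t : 0 <= t <= 1 -> level (w t) by exact: level_segment.
have wB t u : w t - w u = (t - u) *: (y - z).
  by rewrite /w opprD addrACA subrr add0r -scalerBl.
have := @uniformly_convex_segment R (fun t => fine (F (w t)))
  (fun t => G (w t) (y - z)) (s (y - z)) (V * (primal_norm B (y - z) / Ds) `^ r) r.
rewrite /w scale1r scale0r addr0 (addrC z) subrK -/w; apply.
- exact: ltW.
- by rewrite mulr_ge0 ?powR_ge0// ltW.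
- move=> t u /lw lt /lw lu; have := subgrad_le (subG lt) (level_fin_num lu).
  by rewrite wB dual_scaleE mulrC.
- move=> t u u0 ut t1.
  have lt : level (w t) by apply: lw; rewrite t1 (le_trans u0)// ltW.
  have lu : level (w u) by apply: lw; rewrite u0 (le_trans _ t1)// ltW.
  have tu0 : 0 < t - u by rewrite subr_gt0.
  have wtu : w t <> w u.
    move=> /eqP; rewrite -subr_eq0 wB scaler_eq0 gt_eqF//= subr_eq0.
    exact/negP.
  have := betaF_ge lt lu wtu; rewrite /betaF wB dual_scaleE dual_subE.
  have n0 : 0 <= primal_norm B (y - z) / Ds.
    by rewrite divr_ge0 ?primal_norm_ge0 ?(ltW D0).
  rewrite primal_normZ (gtr0_norm tu0) -(mulrA (t - u) _ Ds^-1).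
  rewrite (powRM _ (ltW tu0) n0) -(mulr_powRB1 (ltW tu0) r0) => h.
  rewrite -(ler_pM2l tu0); apply: le_trans h.
  by rewrite le_eqVlt; apply/orP; left; apply/eqP; ring.
- move=> u /lw lu; have := subgrad_le hs (level_fin_num lu).
  by rewrite /w (addrC z) addrK dual_scaleE mulrC.
Qed.

(** With rho = |y - z|, uniform convexity bounds the gap by |s| rho - V (rho/D_s)^r / r, and Young's
    inequality eliminates rho. *)
Lemma gap_le_power y z s : subdifferential F z s -> level y -> level z ->
  fine (F z) - fine (F y) <=
  (r - 1) / r * (dual_norm B s * Ds / V `^ r^-1) `^ (r / (r - 1)).
Proof.
move=> hs ly lz; have := uniform_convexity hs ly lz.
have := young_conjugate_bound (dual_norm_ge0 B s) (primal_norm_ge0 B (y - z))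
  (relative_size_gt0 Ds_fin) VF_gt0 r1.
have := ler_dual_pairing Bsym Bpos s (y - z).
rewrite -/Ds ler_norml => /andP[h1 _] h2 h3.
by apply: le_trans h2; lra.
Qed.

End FiniteOrder.
End Sizes.
End LevelSet.

Lemma Halpha_le (R : realType) (E : finNormedModType R) (B : 'Hom(E, dual_space E))
    (f : E -> R^o) (alpha t q h : R) :
  2 <= q <= 4 -> (Mconst B f q < +oo)%E -> 0 < t -> 0 < h ->
  (h%:E <= Halpha B f alpha t)%E ->
  h <= (6 * fine (Mconst B f q)) `^ (q - 1)^-1 * t `^ ((q - 2) / (q - 1) - alpha).
Proof.
move=> q24 Moo t0 h0 hH; have /andP[q2 q4] := q24.
have w0 : (q - 1)^-1 != 0 by rewrite invr_eq0; apply/eqP; lra.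
have := le_trans hH (ereal_inf_lbound (ex_intro2 _ _ q q24 erefl)).
move: Moo; case: (Mconst B f q) => [M| |] //= _.
  rewrite -EFinM lee_fin => /le_trans; apply.
  by rewrite -(powR_inv1 (ltW t0)) -powRrM mulN1r opprB.
(* M_q = -oo arises when no two distinct points exist; the term at [q] is then 0, against h > 0. *)
rewrite gt0_muleNy// poweRNyr// mul0e lee_fin => h1.
by have := lt_le_trans h0 h1; rewrite ltxx.
Qed.

(** * Invariants along the iterates *)

Section Iterates.
Context {R : realType} {E : finNormedModType R}.
Variables (B : 'Hom(E, dual_space E)) (f : E -> R^o) (psi : E -> \bar R).
Variables (alpha : R) (k : nat) (x : nat -> E) (dpsi : nat -> dual_space E)
  (H : nat -> R) (q eps : R).
Hypotheses (Bsym : self_adjoint B) (Bpos : positive_definite B).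
Hypotheses (cf : convex_function [set: convex_lmodType E] f)
  (df2 : times_differentiable 2 f) (ppsi : eproper psi) (cpsi : econvex psi).
Hypothesis alpha_itv : 2 / 3 <= alpha <= 1.
Hypothesis newton : super_universal_newton B f psi alpha k x dpsi H.
Hypothesis diam_fin : (level_diam B f psi (x 0%N) < +oo)%E.
Hypotheses (q24 : 2 <= q <= 4) (Moo : (Mconst B f q < +oo)%E).
Let g i := dual_norm B (grad f (x i) + dpsi i).
Hypothesis H0_le : ((H 0%N)%:E <= Halpha B f alpha (g 0%N))%E.
Hypothesis eps0 : 0 < eps.
Hypothesis residual_ge : forall i, (i <= k)%N -> (eps%:E <= residual f psi (x i))%E.
Let C := (6 * fine (Mconst B f q)) `^ (q - 1)^-1.
Let theta := (q - 2) / (q - 1).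
Let D := fine (level_diam B f psi (x 0%N)).
Notation level := (level_set f psi (x 0%N)).

Lemma level_start : level (x 0%N).
Proof. by case: newton => px0 _ _ _; split. Qed.

Lemma residual_le_diam y s : level y -> subdifferential psi y s ->
  (residual f psi y <= (dual_norm B (grad f y + s) * D)%:E)%E.
Proof.
move=> ly hs; apply: (residual_le ppsi ly) => z lz.
apply: (gap_le_linear Bsym Bpos ppsi _ lz ly).
  exact: objective_subgrad.
exact: primal_norm_diam_le.
Qed.

Lemma opt_value_is_fin_num : opt_value f psi \is a fin_num.
Proof.
case: newton => _ hs _ _.
apply: (opt_value_fin_num ppsi level_start).
exact: residual_le_diam level_start hs.
Qed.

Lemma residualE y : level y ->
  residual f psi y = (fine (objective f psi y) - fine (opt_value f psi))%:E.
Proof.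
move=> /(level_fin_num ppsi) Fy.
by rewrite EFinB !fineK// opt_value_is_fin_num.
Qed.

(** The residual is at least eps > 0 and at most g_i D, which excludes g_i = 0. *)
Lemma grad_norm_gt0 i : (i <= k)%N -> level (x i) ->
  subdifferential psi (x i) (dpsi i) -> 0 < g i.
Proof.
move=> ik li si; have := le_trans (residual_ge ik) (residual_le_diam li si).
rewrite lee_fin -/(g i) => h; have := lt_le_trans eps0 h.
have : 0 <= g i := dual_norm_ge0 _ _.
by rewrite le_eqVlt => /predU1P[<-|//]; rewrite mul0r ltxx.
Qed.

(** [H 0] is positive and bounded by C times a power of g_0, so C = 0 is impossible. *)
Lemma const_gt0 : 0 < C.
Proof.
case: newton => _ s0 H0 _.
have g0 := grad_norm_gt0 (leq0n k) level_start s0.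
have := lt_le_trans H0 (Halpha_le q24 Moo g0 H0 H0_le).
by rewrite pmulr_lgt0// powR_gt0.
Qed.

(** The accepted pairing is nonnegative, so convexity makes F decrease and the new point stays in
    the level set. Only then is g_(i+1) > 0 known, which the bound on the new [H] requires. *)
Lemma iterate_step i : (i < k)%N -> level (x i) ->
  subdifferential psi (x i) (dpsi i) -> 0 < H i ->
  H i <= 4 * C * g i `^ (theta - alpha) ->
  [/\ level (x i.+1), subdifferential psi (x i.+1) (dpsi i.+1), 0 < H i.+1,
      H i.+1 <= 4 * C * g i.+1 `^ (theta - alpha) &
      g i.+1 ^+ 2 <= 16 * C * g i `^ theta *
        (fine (objective f psi (x i)) - fine (objective f psi (x i.+1)))].
Proof.
move=> ik li si Hi HCi; have gi := grad_norm_gt0 (ltnW ik) li si.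
have stepi : newton_step B f psi alpha (x i) (dpsi i) (H i) (x i.+1) (dpsi i.+1) (H i.+1).
  by case: newton => _ _ _; exact.
have [si1 Hi1 HCi1 dec] := newton_step_spec Bsym Bpos cf df2 ppsi cpsi q24 Moo
  alpha_itv erefl si gi Hi HCi stepi.
have p1 : edom psi (x i.+1) by rewrite /edom/= -(fineK si1.1) ltry.
have ogap := subgrad_le (objective_subgrad cf df2 ppsi si1) (level_fin_num ppsi li).
have K0 : 0 < 16 * C * g i `^ theta by rewrite !mulr_gt0 ?const_gt0 ?powR_gt0.
have S0 : 0 <= (grad f (x i.+1) + dpsi i.+1) (x i - x i.+1).
  by rewrite -(pmulr_rge0 _ K0); apply: le_trans dec; exact: sqr_ge0.
have l1 : level (x i.+1).
  split=> //; apply: le_trans li.2.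
  rewrite -(fineK (objective_fin_num f ppsi p1)) -(fineK (level_fin_num ppsi li)).
  by rewrite lee_fin; lra.
split; [exact: l1|exact: si1|exact: Hi1| |].
  by apply: HCi1; exact: grad_norm_gt0.
by apply: (le_trans dec); rewrite ler_pM2l//; lra.
Qed.

Lemma iterates_invariant i : (i <= k)%N ->
  [/\ level (x i), subdifferential psi (x i) (dpsi i), 0 < H i &
      H i <= 4 * C * g i `^ (theta - alpha)].
Proof.
elim: i => [_|i IH ik].
  case: (newton) => _ s0 H0 _; split=> //; first exact: level_start.
  have g0 := grad_norm_gt0 (leq0n k) level_start s0.
  have := Halpha_le q24 Moo g0 H0 H0_le; rewrite -/C -/theta.
  have : 0 < C * g 0%N `^ (theta - alpha) by rewrite mulr_gt0 ?const_gt0 ?powR_gt0.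
  by lra.
have [li si Hi HCi] := IH (ltnW ik).
by have [] := iterate_step ik li si Hi HCi.
Qed.

(** Common to all values of s, which enters only through the exponent [p], the constant [A] and the
    potential [Phi]. *)
Lemma rate_of_growth (Phi : R -> R) (p A : R) :
  0 <= p <= q / (q - 1) -> 0 < A ->
  (forall a b, 0 < b -> 0 < a -> (a - b) * a `^ (- p) <= Phi b - Phi a) ->
  (forall y s, level y -> subdifferential psi y s ->
    fine (residual f psi y) `^ p <= A * dual_norm B (grad f y + s) `^ (q / (q - 1))) ->
  k%:R <= 16 * C * A * (Phi eps - Phi (fine (residual f psi (x 0%N))))
    + 2 * ln (g 0%N * D / eps).
Proof.
move=> pq A0 hPhi hA; have /andP[q2 q4] := q24.
apply: (abstract_rate (F := fun i => fine (residual f psi (x i))) (p := p) q2) => //.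
- exact: const_gt0.
- by move=> i ik; have [li si _ _] := iterates_invariant ik; exact: grad_norm_gt0.
- move=> i ik; have [li _ _ _] := iterates_invariant ik.
  by have := residual_ge ik; rewrite (residualE li) lee_fin.
- move=> i ik; have [li si _ _] := iterates_invariant ik.
  by have := residual_le_diam li si; rewrite (residualE li) lee_fin.
- by move=> i ik; have [li si _ _] := iterates_invariant ik; exact: hA.
- move=> i ik; have [li si Hi HCi] := iterates_invariant (ltnW ik).
  have [li1 _ _ _ dec] := iterate_step ik li si Hi HCi.
  rewrite (residualE li) (residualE li1)/=; apply: (le_trans dec).
  by rewrite ler_wpM2l ?mulr_ge0 ?powR_ge0//; lra.
Qed.

End Iterates.

(** * Constants of the rate and the cases of [s] *)

Lemma powR_const_split (R : realType) (M Ds V q r w : R) :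
  0 <= M -> 0 <= Ds -> 0 < V ->
  (6 * M * Ds `^ q / V `^ (q / r)) `^ w =
  (6 * M) `^ w * (Ds / V `^ r^-1) `^ (q * w).
Proof.
move=> M0 Ds0 V0; have V1 : 0 <= (V `^ r^-1)^-1 by rewrite invr_ge0 powR_ge0.
have e : (V `^ r^-1)^-1 `^ q = (V `^ (q / r))^-1.
  by rewrite -powRN -powRrM mulNr (mulrC r^-1) powRN.
rewrite [in RHS]powRrM (powRM _ Ds0 V1) e -mulrA.
by rewrite powRM ?mulr_ge0 ?invr_ge0 ?powR_ge0.
Qed.

Lemma powR_gap_le (R : realType) (a b c e p : R) : 0 <= a -> 0 <= c -> 0 <= p ->
  a <= c * b `^ e -> a `^ p <= c `^ p * b `^ (e * p).
Proof.
move=> a0 c0 p0 h; rewrite powRrM -powRM ?powR_ge0//.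
by apply: ge0_ler_powR; rewrite ?nnegrE ?mulr_ge0 ?powR_ge0.
Qed.

Theorem theorem4 (R : realType) (E : finNormedModType R)
    (B : 'Hom(E, dual_space E)) (f : E -> R^o) (psi : E -> \bar R)
    (alpha : R) (k : nat) (x : nat -> E) (dpsi : nat -> dual_space E) (H : nat -> R)
    (G : E -> dual_space E) (q : R) (s : \bar R) (eps : R) :
  self_adjoint B -> positive_definite B ->
  convex_function [set: convex_lmodType E] f -> times_differentiable 2 f ->
  eproper psi -> lower_semicontinuous psi -> econvex psi ->
  strictly_econvex (objective f psi) ->
  2 / 3 <= alpha <= 1 ->
  super_universal_newton B f psi alpha k x dpsi H ->
  (exists y z, [/\ level_set f psi (x 0%N) y, level_set f psi (x 0%N) z &
    y <> z]) ->
  (level_diam B f psi (x 0%N) < +oo)%E ->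
  (forall y, level_set f psi (x 0%N) y ->
    subdifferential (objective f psi) y (G y)) ->
  (VF f psi G (x 0%N) < +oo)%E ->
  2 <= q <= 4 -> (Mconst B f q < +oo)%E ->
  (q%:E <= s)%E -> (relative_size B f psi G (x 0%N) s < +oo)%E ->
  ((H 0%N)%:E <= Halpha B f alpha (dual_norm B (grad f (x 0%N) + dpsi 0%N)%R))%E ->
  0 < eps ->
  (forall i, (i <= k)%N -> (eps%:E <= residual f psi (x i))%E) ->
  k%:R <= rate_bound q s (fine (Mconst B f q))
            (fine (relative_size B f psi G (x 0%N) s))
            (fine (VF f psi G (x 0%N)))
            (dual_norm B (grad f (x 0%N) + dpsi 0%N))
            (fine (level_diam B f psi (x 0%N)))
            (fine (residual f psi (x 0%N))) eps.

Proof.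
move=> Bsym Bpos cf df2 ppsi lsc cpsi strictF alpha_itv newton nontriv diam_fin.
move=> subG V_fin q24 Moo qs Ds_fin H0_le eps0 res.
have /andP[q2 q4] := q24; have q1 : 0 < q - 1 by lra.
have M0 := Mconst_ge0 B f q.
have V0 := VF_gt0 ppsi strictF nontriv subG V_fin.
have D0 := relative_size_gt0 Bpos ppsi strictF nontriv subG V_fin Ds_fin.
have lx0 := level_start newton.
have rate := rate_of_growth Bsym Bpos cf df2 ppsi cpsi alpha_itv newton diam_fin
  q24 Moo H0_le eps0 res.
have resE := residualE Bsym Bpos cf df2 ppsi newton diam_fin.
have resle := residual_le_diam Bsym Bpos cf df2 ppsi diam_fin.
have residual_ge0 y : level_set f psi (x 0%N) y -> 0 <= fine (residual f psi y).
  move=> ly; have Fy := level_fin_num ppsi ly.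
  rewrite (resE _ ly)/= subr_ge0 -lee_fin fineK.
    by rewrite fineK//; apply: ereal_inf_lbound; exists y => //; exact: ly.1.
  exact: opt_value_is_fin_num Bsym Bpos cf df2 ppsi newton diam_fin.
have F0eps : 0 < fine (residual f psi (x 0%N)).
  by have := res _ (leq0n k); rewrite (resE _ lx0) lee_fin; exact: lt_le_trans.
(* s = -oo contradicts q <= s. The case s = +oo is treated first, with p = 1 + w and the potential
   t^(-w)/w. *)
case: s qs Ds_fin D0 => [r| |] // qs Ds_fin D0; last first.
  set Ds := fine (relative_size _ _ _ _ _ _) in D0 *.
  set M := fine (Mconst _ _ _) in M0 *; set w := (q - 1)^-1.
  have w0 : 0 < w by rewrite invr_gt0.
  have qw : q * w = 1 + w by rewrite /w; field; rewrite gt_eqF.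
  (* [inv_size] of +oo is 0, so the factor xi^0 is 1 and D_s itself bounds the distances. *)
  have normD y z : level_set f psi (x 0%N) y -> level_set f psi (x 0%N) z ->
      primal_norm B (y - z) <= Ds.
    move=> ly lz; have [->|/eqP yz] := eqVneq y z.
      by rewrite subrr /primal_norm linear0 sqrtr0 ltW.
    by have := relative_size_le Ds_fin ly lz yz; rewrite /= oppr0 powRr0 mulr1.
  have hPhi a b : 0 < b -> 0 < a ->
      (a - b) * a `^ (- (q * w)) <= b `^ (- w) / w - a `^ (- w) / w.
    by move=> b0 a0; rewrite qw; exact: powR_potential_le.
  have qw0 : 0 <= q * w by rewrite qw addr_ge0// ltW.
  have gap y s : level_set f psi (x 0%N) y -> subdifferential psi y s ->
      fine (residual f psi y) `^ (q * w) <=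
      Ds `^ (q * w) * dual_norm B (grad f y + s) `^ (q * w).
    move=> ly sy.
    have hle : (residual f psi y <= (dual_norm B (grad f y + s) * Ds)%:E)%E.
      apply: (residual_le ppsi ly) => z lz.
      apply: (gap_le_linear Bsym Bpos ppsi _ lz ly); last exact: normD.
      exact: objective_subgrad.
    have {}hle : fine (residual f psi y) <= dual_norm B (grad f y + s) * Ds.
      by move: hle; rewrite (resE _ ly) lee_fin.
    rewrite [leRHS]mulrC -(powRM _ (dual_norm_ge0 B _) (ltW D0)).
    have gD0 : 0 <= dual_norm B (grad f y + s) * Ds.
      exact: mulr_ge0 (dual_norm_ge0 B _) (ltW D0).
    by apply: ge0_ler_powR hle; rewrite ?nnegrE// residual_ge0.
  have := rate (fun t => t `^ (- w) / w) (q * w) (Ds `^ (q * w)) _ _ hPhi gap.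
  rewrite qw0 lexx powR_gt0// => /(_ isT isT).
  have CA : (6 * M) `^ w * Ds `^ (q * w) = (6 * M * Ds `^ q) `^ w.
    by rewrite [in LHS]powRrM -powRM ?mulr_ge0 ?powR_ge0.
  rewrite -(mulrA 16) CA -mulrBl (mulrC _ w^-1) invrK !mulrA; exact.
rewrite lee_fin in qs.
have r1 : 1 < r by lra.
have r0 : 0 < r by lra.
set Ds := fine (relative_size _ _ _ _ _ _) in D0 *.
set V := fine (VF _ _ _ _) in V0 *; set M := fine (Mconst _ _ _) in M0 *.
(* Chosen so that raising the gap bound to the power [p] turns its exponent r/(r-1) into q/(q-1). *)
pose p := q * (r - 1) / (r * (q - 1)).
have pE : r / (r - 1) * p = q / (q - 1) by rewrite /p; field; lra.
have c0 : 0 < (r - 1) / r by rewrite divr_gt0//; lra.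
have p0 : 0 <= p by rewrite /p divr_ge0 ?mulr_ge0//; lra.
have pq : p <= q / (q - 1).
  rewrite -pE ler_peMl// ler_pdivlMr; lra.
pose A := ((r - 1) / r) `^ p * (Ds / V `^ r^-1) `^ (q / (q - 1)).
have W0 : 0 < Ds / V `^ r^-1 by rewrite divr_gt0// powR_gt0.
have A0 : 0 < A by rewrite mulr_gt0// powR_gt0.
have gap y s : level_set f psi (x 0%N) y -> subdifferential psi y s ->
    fine (residual f psi y) `^ p <= A * dual_norm B (grad f y + s) `^ (q / (q - 1)).
  move=> ly sy.
  have hle : (residual f psi y <= ((r - 1) / r *
      (dual_norm B (grad f y + s) * Ds / V `^ r^-1) `^ (r / (r - 1)))%:E)%E.
    apply: (residual_le ppsi ly) => z lz.
    apply: (gap_le_power Bsym Bpos cf ppsi cpsi strictF nontriv subG V_fin r1 Ds_fin _ lz ly).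
    exact: objective_subgrad.
  have {}hle : fine (residual f psi y) <= (r - 1) / r *
      (dual_norm B (grad f y + s) * Ds / V `^ r^-1) `^ (r / (r - 1)).
    by move: hle; rewrite (resE _ ly) lee_fin.
  apply: (le_trans (powR_gap_le (residual_ge0 y ly) (ltW c0) p0 hle)).
  rewrite pE -[X in X `^ (q / _)]mulrA (powRM _ (dual_norm_ge0 B _) (ltW W0)).
  by rewrite /A [leRHS]mulrAC mulrA.
have CA : (6 * M) `^ (q - 1)^-1 * A =
    ((r - 1) / r) `^ p * (6 * M * Ds `^ q / V `^ (q / r)) `^ (q - 1)^-1.
  by rewrite (powR_const_split _ _ _ M0 (ltW D0) V0) mulrCA.
set F0 := fine (residual _ _ _) in F0eps *.
rewrite /rate_bound; have [rq|rq] := eqVneq r q.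
  (* At s = q the exponent is 1 and the potential becomes -ln t. *)
  have p1 : p = 1 by rewrite /p rq; field; lra.
  have hPhi a b : 0 < b -> 0 < a -> (a - b) * a `^ (- p) <= - ln b - - ln a.
    move=> b0 a0; rewrite p1 powR_inv1 ?(ltW a0)//.
    by have := ln_potential_le b0 a0; lra.
  have := rate (fun t => - ln t) p A _ A0 hPhi gap; rewrite p0 pq => /(_ isT).
  rewrite -(mulrA 16) CA p1 rq powRr1 -?rq ?(ltW c0)// divff ?gt_eqF// powRr1 ?(ltW V0)//.
  have -> : - ln eps - - ln F0 = ln (F0 / eps) by rewrite ln_div ?posrE//; lra.
  by rewrite !mulrA; exact.
(* For s > q, p = 1 + m with m > 0; the 1/m of the potential t^(-m)/m is the factor r(q-1)/(r-q) of
   the rate. *)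
pose m := (r - q) / (r * (q - 1)).
have rq' : 0 < r - q by rewrite subr_gt0 lt_neqAle eq_sym rq.
have m0 : 0 < m by rewrite divr_gt0// mulr_gt0.
have pm : p = 1 + m by rewrite /p /m; field; lra.
have hPhi a b : 0 < b -> 0 < a -> (a - b) * a `^ (- p) <= b `^ (- m) / m - a `^ (- m) / m.
  by move=> b0 a0; rewrite pm; exact: powR_potential_le.
have := rate (fun t => t `^ (- m) / m) p A _ A0 hPhi gap; rewrite p0 pq => /(_ isT).
rewrite -(mulrA 16) CA -/m -/p -mulrBl.
have -> : r * (q - 1) / (r - q) = m^-1 by rewrite /m invf_div.
rewrite (mulrC _ m^-1) !mulrA; exact.
Qed.
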